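(* Consider the problem $\min_{x\in\mathcal H}F(x)=f(x)+\psi(x)$ described in the context. Suppose there is $L\ge0$ with $$\|f'(y)-f'(x)-H(x)(y-x)\|_*\le L\|x-y\|\qquad\text{for all }x,y\in\mathcal H,$$ that the subproblem assumption (see context) holds with this $L$, and that for some $\mu>0$, $$\frac1{2\mu}\operatorname{dist}(0,\partial F(x))^2\ge F(x)-F^*\qquad\text{for all }x\in\operatorname{dom}F.$$ Let $(x_k)_{k\in\mathbb N}$ be the iterates of the LeAP-SSN algorithm (see context) with arbitrary $x_0\in\operatorname{dom}F$, and let $x^*$ be the limit point of $(x_k)$. Suppose additionally that $F$ is convex in a neighbourhood of $x^*$, that $f'$ is semismooth (Newton differentiable) at $x^*$ with respect to $H$, that $H(x_k)\succeq0$ for all sufficiently large $k$, and that, writing $x_{k,+}=x_+(\lambda_k/2,x_k)$, either $$\|(H(x_{k,+})-H(x_k))(x_{k,+}-x^* )\|_*=o(\|x_{k,+}-x_k\|)\quad\text{as }k\to\infty$$ or $$\frac{\|f'(x_{k,+})-f'(x_k)-H(x_k)(x_{k,+}-x_k)\|_*}{\|x_{k,+}-x_k\|}\to0\quad\text{as }k\to\infty.$$ Then $x^*$ is a global minimum of $F$, and, as $k\to\infty$, $x_k\to x^*$ superlinearly, $F(x_k)-F^*\to0$ superlinearly, and $\|F'(x_k)\|_*\to0$ superlinearly.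
   Context: Setting. $\mathcal H$ is a real Hilbert space with norm $\|\cdot\|$, dual $\mathcal H^*$ with norm $\|\cdot\|_*$, duality pairing $\langle\cdot,\cdot\rangle$, and Riesz map $\mathcal R:\mathcal H\to\mathcal H^*$. $f\in C^{1,1}(\mathcal H;\mathbb R)$ (Fréchet differentiable with Lipschitz derivative $f'$, possibly nonconvex); $\psi:\mathcal H\to\mathbb R\cup\{+\infty\}$ is proper, convex, lower semicontinuous; $F=f+\psi$ is bounded below with minimal value $F^*$ and the solution set $S=\{x:F(x)=F^*\}$ is nonempty. $\operatorname{dom}F=\{F<+\infty\}$; $\partial\psi$ is the convex subdifferential and $\partial F(x)=f'(x)+\partial\psi(x)$; $\operatorname{dist}(0,\partial F(x))=\inf\{\|g\|_*:g\in\partial F(x)\}$ ($+\infty$ if $\partial F(x)=\emptyset$). To every $x\in\mathcal H$ is associated a symmetric bounded linear operator $H(x):\mathcal H\to\mathcal H^*$; $H(x)\succeq0$ means $\langle H(x)d,d\rangle\ge0$ for all $d\in\mathcal H$. $f'$ is semismooth (Newton differentiable) at $x^*$ with respect to $H$ if $\lim_{h\to0}\|f'(x^*+h)-f'(x^* )-H(x^*+h)h\|_*/\|h\|=0$. Subproblem. For $x\in\operatorname{dom}F$ and $\lambda\ge0$ let $\widetilde F(y;x,\lambda)=f(x)+\langle f'(x),y-x\rangle+\frac12\langle H(x)(y-x),y-x\rangle+\frac\lambda2\|y-x\|^2+\psi(y)$. A point $x_+=x_+(\lambda,x)$ is an admissible solution if (FO) $-f'(x)-H(x)(x_+-x)-\lambda\mathcal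 R(x_+-x)\in\partial\psi(x_+)$ and (D) $\widetilde F(x_+;x,\lambda)\le\widetilde F(x;x,\lambda)=F(x)$. If $H(x)\succeq0$ and $\lambda>0$, $x_+(\lambda,x)$ is the unique minimiser of the strongly convex function $\widetilde F(\cdot;x,\lambda)$. For an admissible solution set $\psi'(x_+)=-f'(x)-H(x)(x_+-x)-\lambda\mathcal R(x_+-x)$ and $F'(x_+)=f'(x_+)+\psi'(x_+)\in\partial F(x_+)$. Subproblem assumption (with constant $L$): for all $\lambda\ge L$ and all $x\in\operatorname{dom}F$ an admissible solution exists (and can be computed). LeAP-SSN algorithm. Input: $m\ge1$, $\alpha\in(0,1/2]$, $\beta\in(0,(m-1)/(2m)]$, $x_0\in\operatorname{dom}F$, $\psi'(x_0)\in\partial\psi(x_0)$, $\Lambda_0>0$; $F'(x_0)=f'(x_0)+\psi'(x_0)$. At iteration $k=0,1,\dots$: for $j=0,1,\dots$, set $\lambda=2^j\Lambda_k$; take an admissible solution $x_+=x_+(\lambda,x_k)$ (if none exists, go to the next $j$); if $$\langle F'(x_+),x_k-x_+\rangle\ge\tfrac\alpha\lambda\|F'(x_+)\|_*^2\quad\text{and}\quad F(x_k)-F(x_+)\ge\beta\lambda\|x_+-x_k\|^2,$$ accept: set $j_k=j$, $x_{k+1}=x_+$, $\lambda_k=\lambda=2^{j_k}\Lambda_k$, $\Lambda_{k+1}=\lambda_k/2$, $F'(x_{k+1})=F'(x_+)$ and go to iteration $k+1$; otherwise go to the next $j$. A nonnegative sequence $(a_k)$ converges to $0$ superlinearly if $a_{k+1}\le\varepsilon_ka_k$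 for all large $k$ with some $\varepsilon_k\to0$; $x_k\to x^*$ superlinearly means this for $a_k=\|x_k-x^*\|$. Quotients with zero denominator (in which case the numerator vanishes too) are read as $0$. *)

(* Defs.v *)
From HB Require Import structures.
From mathcomp Require Export all_boot all_order all_algebra.
From mathcomp Require Export all_classical all_reals all_analysis.

Set Implicit Arguments.
Unset Strict Implicit.
Unset Printing Implicit Defensive.

Export Order.TTheory GRing.Theory Num.Theory.
Export numFieldNormedType.Exports.

Local Open Scope classical_set_scope.
Local Open Scope ring_scope.

(* Elements of the dual are represented by functions [H -> R^o] (which form an
   lmodType under pointwise operations) satisfying [in_dual]; the duality
   pairing of [phi] and [d] is [phi d]. *)
Section Dual.
Context {R : realType} {H : completeNormedModType R}.

Definition in_dual (phi : H -> R^o) : Prop := linear phi /\ continuous phi.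

(* Only meaningful under [in_dual]: the real-valued [sup] of an unbounded set
   is 0. *)
Definition dual_norm (phi : H -> R^o) : R :=
  sup [set `|phi d| | d in [set d : H | `|d| <= 1]].

(* The inner product makes the Banach space [H] a Hilbert space. *)
Definition hilbert (ip : {dot H for idfun}) : Prop :=
  forall x : H, ip x x = `|x| ^+ 2.

Definition riesz (ip : {dot H for idfun}) (x : H) : H -> R^o := fun y => ip x y.

Record sym_bounded_op (A : H -> H -> R^o) : Prop := {
  sbo_dual : forall d, in_dual (A d);
  sbo_linear : linear A;
  sbo_bounded : exists C : R, forall d, dual_norm (A d) <= C * `|d|;
  sbo_sym : forall d e, A d e = A e d }.

Definition psd (A : H -> H -> R^o) : Prop := forall d, 0 <= A d d.

End Dual.

Section Functions.
Context {R : realType} {H : completeNormedModType R}.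
Implicit Types (f : H -> R^o) (psi : H -> \bar R).

Definition fder f (x : H) : H -> R^o := 'd f x.

Definition C11 f : Prop :=
  (forall x, differentiable f x) /\
  exists K : R, forall x y, dual_norm (fder f y - fder f x) <= K * `|y - x|.

Definition proper psi : Prop :=
  (forall x, psi x != -oo%E) /\ exists x, (psi x < +oo)%E.

(* [0%:E * +oo = 0] in the library, so the endpoints t = 0, 1 are harmless. *)
Definition convex_on (D : set H) (G : H -> \bar R) : Prop :=
  forall x y (t : R), D x -> D y -> 0 <= t <= 1 ->
    (G (t *: x + (1 - t) *: y)%R
       <= t%:E * G x + (1 - t)%:E * G y)%E.

(* Empty when [psi x = +oo] and [psi] is proper. *)
Definition subdiff psi (x : H) : set (H -> R^o) :=
  [set g | in_dual g /\ forall y, (psi x + (g (y - x))%:E <= psi y)%E].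

Definition objective f psi (x : H) : \bar R := ((f x)%:E + psi x)%E.

Definition domain (G : H -> \bar R) : set H := [set x | (G x < +oo)%E].

Definition obj_subdiff f psi (x : H) : set (H -> R^o) :=
  [set fder f x + g | g in subdiff psi x].

Definition dist0 (A : set (H -> R^o)) : \bar R :=
  ereal_inf [set (dual_norm g)%:E | g in A].

(* Newton differentiability of f' at z with respect to B. *)
Definition semismooth f (B : H -> H -> H -> R^o) (z : H) : Prop :=
  (dual_norm (fder f (z + h) - fder f z - B (z + h) h) / `|h|)
    @[h --> (0 : H)^'] --> (0 : R).

Definition superlinear (a : nat -> R) : Prop :=
  exists2 eps : nat -> R,
    eps @ \oo --> (0 : R) & \forall k \near \oo, a k.+1 <= eps k * a k.

End Functions.

Section Algorithm.
Context {R : realType} {H : completeNormedModType R}.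
Variables (ip : {dot H for idfun}) (f : H -> R^o) (psi : H -> \bar R)
  (B : H -> H -> H -> R^o).
Local Notation F := (objective f psi).

Definition model (x : H) (lam : R) (y : H) : \bar R :=
  ((f x + fder f x (y - x) + 2^-1 * B x (y - x) (y - x)
    + lam / 2 * `|y - x| ^+ 2)%:E + psi y)%E.

(* psi'(x_+) and F'(x_+) for x_+ = y computed from x with parameter lam. *)
Definition psi_der (x : H) (lam : R) (y : H) : H -> R^o :=
  - fder f x - B x (y - x) - lam *: riesz ip (y - x).

Definition obj_der (x : H) (lam : R) (y : H) : H -> R^o :=
  fder f y + psi_der x lam y.

Definition admissible (x : H) (lam : R) (y : H) : Prop :=
  subdiff psi y (psi_der x lam y) /\ (model x lam y <= model x lam x)%E.

Definition subproblem_assumption (L : R) : Prop :=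
  forall (lam : R) x, L <= lam -> domain F x -> exists y, admissible x lam y.

Definition accept (alpha beta : R) (x : H) (lam : R) (y : H) : Prop :=
  alpha / lam * dual_norm (obj_der x lam y) ^+ 2 <= obj_der x lam y (x - y) /\
  ((beta * lam * `|y - x| ^+ 2)%:E <= F x - F y)%E.

(* [xp k lam] is the solution x_+(lam, x_k) selected at iteration k; it is
   unconstrained when no admissible solution exists.  [Lam k], [lam k], [j k]
   are Lambda_k, lambda_k, j_k, and [dF k] is F'(x_k). *)
Record leap_ssn (m alpha beta : R) (x : nat -> H) (dF : nat -> H -> R^o)
    (Lam lam : nat -> R) (j : nat -> nat) (xp : nat -> R -> H) : Prop := {
  leap_m : 1 <= m;
  leap_alpha : 0 < alpha <= 2^-1;
  leap_beta : 0 < beta <= (m - 1) / (2 * m);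
  leap_x0 : domain F (x 0%N);
  leap_dF0 : obj_subdiff f psi (x 0%N) (dF 0%N);
  leap_Lam0 : 0 < Lam 0%N;
  leap_sel : forall k l, 0 <= l ->
    (exists y, admissible (x k) l y) -> admissible (x k) l (xp k l);
  leap_lam : forall k, lam k = 2 ^+ j k * Lam k;
  leap_admissible : forall k, admissible (x k) (lam k) (xp k (lam k));
  leap_accept : forall k, accept alpha beta (x k) (lam k) (xp k (lam k));
  leap_reject : forall k i, (i < j k)%N ->
    ~ (admissible (x k) (2 ^+ i * Lam k) (xp k (2 ^+ i * Lam k)) /\
       accept alpha beta (x k) (2 ^+ i * Lam k) (xp k (2 ^+ i * Lam k)));
  leap_next : forall k, x k.+1 = xp k (lam k);
  leap_dF : forall k, dF k.+1 = obj_der (x k) (lam k) (x k.+1);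
  leap_Lam : forall k, Lam k.+1 = lam k / 2 }.

End Algorithm.

(* Main.v *)
From HB Require Import structures.
Require Import Defs.
From mathcomp Require Import ring lra.

Set Implicit Arguments.
Unset Strict Implicit.
Unset Printing Implicit Defensive.

Local Open Scope classical_set_scope.
Local Open Scope ring_scope.

(** Write delta_k = F(x_k) - Fstar and t_k = ||x_(k+1) - x_k||. The two
    acceptance tests say that beta lam_k t_k^2 <= delta_k - delta_(k+1) and that
    alpha ||F'(x_(k+1))|| <= lam_k t_k, and the Polyak-Lojasiewicz inequality
    turns the second one into delta_(k+1) = O(lam_k^2 t_k^2). Together they give
    delta_(k+1) = O(lam_k delta_k), so everything is governed by lam_k: bounded
    lam_k yields linear convergence of delta_k, and lam_k -> 0 superlinear
    convergence of delta_k and of ||F'(x_k)||.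

    The iterates need one more remark. The decrease test alone only bounds t_k by
    sqrt(delta_k / lam_k), which is useless for small lam_k; but lam is at most
    halved in one iteration, so the factor lam_k in delta_(k+1) = O(lam_k delta_k)
    compensates the 1 / lam_(k+1), and t_(k+1) = O(sqrt delta_k)
    ([step_le_sqrt_gap]). Hence the step lengths are summable, the iterates
    converge, and ||x_(k+1) - xstar|| is bounded by a multiple of
    (sqrt lam_k + lam_k) t_k ([next_distance_le_step]). This is a superlinear
    rate as soon as lam_k -> 0, and it also shows ||x_k - xstar|| = O(t_k),
    whether or not the minimisers are isolated.

    That lam_k is bounded holds because every lam >= m L passes both tests: with
    e = f'(x_+) - f'(x) - B(x)(x_+ - x), the gradient test follows from
    ||e|| <= lam ||x_+ - x|| ([riesz_perturbation_cocoercive]), and the decrease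
    test from a quadratic upper bound of f and the decrease of the model.

    That lam_k -> 0 is where the local hypotheses enter. If lam_k is not simply
    half of lam_(k-1), then lam_k / 2 was rejected. Since B(x_k) is positive
    semidefinite the trial point x_(k,+) for lam_k / 2 exists
    ([psd_admissible_exists]), and its distance to x_k lies between t_k and 2 t_k
    ([prox_step_antimonotone]); consequently x_(k,+) -> xstar and
    ||x_k - xstar|| = O(||x_(k,+) - x_k||). With this comparison either of the
    two alternative hypotheses says that the residual e of the trial step is
    o(||x_(k,+) - x_k||). Local convexity of F gives the
    decrease test for such a step once ||e|| is small against
    lam_k ||x_(k,+) - x_k|| ([decrease_test_of_local_convexity]), so a rejection
    forces lam_k = o(1). *)

(** * The dual space and the inner product *)

Section Dual.
Context {R : realType} {H : completeNormedModType R}.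
Implicit Types (phi chi : H -> R^o) (u v d : H).

Lemma in_dualP phi a u v : in_dual phi -> phi (a *: u + v) = a * phi u + phi v.
Proof. by case=> /(_ a u v). Qed.

Lemma in_dual0 phi : in_dual phi -> phi 0 = 0.
Proof.
by move=> hp; have := in_dualP (-1) 0 0 hp; rewrite scaler0 addr0 mulN1r addNr.
Qed.

Lemma in_dualZ phi a u : in_dual phi -> phi (a *: u) = a * phi u.
Proof. by move=> hp; rewrite -[a *: u]addr0 in_dualP// in_dual0// addr0. Qed.

Lemma in_dualD phi u v : in_dual phi -> phi (u + v) = phi u + phi v.
Proof. by move=> hp; rewrite -[u]scale1r in_dualP// mul1r scale1r. Qed.

Lemma in_dualN phi u : in_dual phi -> phi (- u) = - phi u.
Proof. by move=> hp; rewrite -scaleN1r in_dualZ// mulN1r. Qed.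

Lemma in_dualB phi u v : in_dual phi -> phi (u - v) = phi u - phi v.
Proof. by move=> hp; rewrite in_dualD// in_dualN. Qed.

Lemma in_dual_add phi chi : in_dual phi -> in_dual chi -> in_dual (phi + chi).
Proof.
move=> hp hc; split.
  move=> a u v; rewrite !fctE !in_dualP// scalerDr.
  by rewrite /GRing.scale/=; ring.
by move=> z; apply: continuousD; [exact: hp.2|exact: hc.2].
Qed.

Lemma in_dual_scale phi a : in_dual phi -> in_dual (a *: phi).
Proof.
move=> hp; split.
  by move=> b u v; rewrite !fctE in_dualP// /GRing.scale/=; ring.
by move=> z; apply: continuousZr; exact: hp.2.
Qed.

Lemma in_dual_opp phi : in_dual phi -> in_dual (- phi).
Proof. by move=> hp; rewrite -scaleN1r; apply: in_dual_scale. Qed.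

Lemma in_dual_sub phi chi : in_dual phi -> in_dual chi -> in_dual (phi - chi).
Proof. by move=> hp hc; apply: in_dual_add => //; exact: in_dual_opp. Qed.

(** Ensures that [dual_norm] is the supremum of a bounded set, hence the operator
    norm. *)
Lemma in_dual_bounded phi : in_dual phi ->
  exists2 C, 0 <= C & forall d, `|phi d| <= C * `|d|.
Proof.
move=> hp.
pose f : {linear H -> R^o} :=
  HB.pack phi (GRing.isLinear.Build _ _ _ _ phi hp.1).
have /linear_bounded_continuous/linear_boundedP [y [yr hy]] : continuous f.
  exact: hp.2.
exists (Num.max y 0 + 1); first by rewrite addr_ge0// le_max lexx orbT.
by move=> d; apply: hy; rewrite ltr_pwDr// le_max lexx.
Qed.

Lemma dual_norm_bound phi d : in_dual phi -> `|phi d| <= dual_norm phi * `|d|.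
Proof.
move=> hp; have [C C0 hC] := in_dual_bounded hp.
have [->|d0] := eqVneq d 0; first by rewrite in_dual0// !normr0 mulr0.
have nd : 0 < `|d| by rewrite normr_gt0.
rewrite -ler_pdivrMr//.
have -> : `|phi d| / `|d| = `|phi (`|d|^-1 *: d)|.
  by rewrite in_dualZ// normrM ger0_norm ?invr_ge0// mulrC.
apply: ub_le_sup.
  exists C => _ [e /= he <-]; rewrite (le_trans (hC e))//.
  by rewrite ler_piMr.
exists (`|d|^-1 *: d) => //=.
by rewrite normrZ ger0_norm ?invr_ge0// mulVf// gt_eqF.
Qed.

Lemma dual_le phi d : in_dual phi -> phi d <= dual_norm phi * `|d|.
Proof. by move=> hp; rewrite (le_trans (ler_norm _))// dual_norm_bound. Qed.

Lemma dual_norm_le phi C : (forall d, `|d| <= 1 -> `|phi d| <= C) ->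
  dual_norm phi <= C.
Proof.
move=> hC; apply: ge_sup; first by exists `|phi 0|, 0 => //=; rewrite normr0.
by move=> _ [d /= hd <-]; exact: hC.
Qed.

Lemma dual_norm_ge0 phi : in_dual phi -> 0 <= dual_norm phi.
Proof.
move=> hp; have [C C0 hC] := in_dual_bounded hp.
apply: ub_le_sup; last by exists 0; rewrite /= ?normr0// in_dual0// normr0.
exists C => _ [e /= he <-]; rewrite (le_trans (hC e))//.
by rewrite ler_piMr.
Qed.

Lemma dual_norm_triangle phi chi : in_dual phi -> in_dual chi ->
  dual_norm (phi + chi) <= dual_norm phi + dual_norm chi.
Proof.
move=> hp hc; apply: dual_norm_le => d hd; rewrite fctE.
rewrite (le_trans (ler_normD _ _))// lerD//.
  by rewrite (le_trans (dual_norm_bound _ hp))// ler_piMr// dual_norm_ge0.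
by rewrite (le_trans (dual_norm_bound _ hc))// ler_piMr// dual_norm_ge0.
Qed.

Lemma dual_normN phi : dual_norm (- phi) = dual_norm phi.
Proof.
by congr sup; apply: eq_imagel => d _; rewrite fctE normrN.
Qed.

End Dual.

Section Hilbert.
Context {R : realType} {H : completeNormedModType R} (ip : {dot H for idfun}).
Hypothesis hip : hilbert ip.

Lemma ipC u v : ip u v = ip v u.
Proof. by rewrite hermC expr0 mul1r. Qed.

Lemma ipZl a u v : ip (a *: u) v = a * ip u v.
Proof. exact: linearZl_LR. Qed.

Lemma ipDl u v w : ip (u + v) w = ip u w + ip v w.
Proof. exact: linearDl. Qed.

Lemma ipBr u v w : ip u (v - w) = ip u v - ip u w.
Proof. exact: linearBr. Qed.

Lemma normD_sqr u v : `|u + v| ^+ 2 = `|u| ^+ 2 + 2 * ip u v + `|v| ^+ 2.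
Proof.
by rewrite -!hip ipDl ipC ipDl (ipC v (u + v)) ipDl (ipC v u); ring.
Qed.

Lemma normB_sqr u v : `|u - v| ^+ 2 = `|u| ^+ 2 - 2 * ip u v + `|v| ^+ 2.
Proof. by rewrite normD_sqr normrN linearNr mulrN. Qed.

Lemma ip_cauchy_schwarz u v : `|ip u v| <= `|u| * `|v|.
Proof.
have key w z : ip w z <= `|w| * `|z|.
  have [->|w0] := eqVneq w 0; first by rewrite linear0l normr0 mul0r.
  have [->|z0] := eqVneq z 0; first by rewrite linear0r normr0 mulr0.
  have nw : 0 < `|w| by rewrite normr_gt0.
  have nz : 0 < `|z| by rewrite normr_gt0.
  have := exprn_ge0 2 (normr_ge0 (`|z| *: w - `|w| *: z)).
  rewrite normB_sqr !normrZ !normr_id ipZl (ipC w) ipZl (ipC z).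
  rewrite (_ : _ + _ = 2 * (`|w| * `|z|) * (`|w| * `|z| - ip w z)); last by ring.
  by rewrite pmulr_rge0 ?mulr_gt0// subr_ge0.
rewrite ler_norml key andbT lerNl -linearNr (le_trans (key _ _))//.
by rewrite normrN.
Qed.

Lemma in_dual_riesz u : in_dual (riesz ip u).
Proof.
have hl : linear (riesz ip u : H -> R^o).
  by move=> a v w; rewrite /riesz linearDr linearZr_LR.
split=> //.
pose f : {linear H -> R^o} :=
  HB.pack (riesz ip u : H -> R^o)
    (GRing.isLinear.Build _ _ _ _ (riesz ip u : H -> R^o) hl).
have : continuous f; last by [].
apply/linear_bounded_continuous/linear_boundedP.
exists `|u|; split; first exact: num_real.
move=> r ur v; rewrite (le_trans (ip_cauchy_schwarz _ _))//.
by rewrite ler_wpM2r// ltW.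
Qed.

(** With g = e - l R d, this is the cocoercivity estimate
    ||g||^2 <= 2 l <g, - d>. Testing e against d - s v, for a vector v of the unit
    ball and a real s, gives e(d) - s e(v) <= l ||d|| ||d - s v||, whose right-hand
    side is at most l (||d||^2 + ||d - s v||^2) / 2; the best s bounds g(v)^2. *)
Lemma riesz_perturbation_cocoercive (e : H -> R^o) l d : in_dual e -> 0 < l ->
  dual_norm e <= l * `|d| ->
  dual_norm (e - l *: riesz ip d) ^+ 2 <= 2 * l * (l * `|d| ^+ 2 - e d).
Proof.
move=> he l0 hel; set g := (_ - _).
have hg : in_dual g.
  by apply: in_dual_sub => //; apply: in_dual_scale; exact: in_dual_riesz.
have gE v : g v = e v - l * ip d v by rewrite /g !fctE.
have d0 := normr_ge0 d.
have key v : `|v| <= 1 -> g v ^+ 2 <= 2 * l * (l * `|d| ^+ 2 - e d).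
  (* s is the exact line minimiser along v of the quadratic bound on - s g(v). *)
  move=> hv; set s := - g v / l.
  have ls : l * s = - g v by rewrite /s mulrC divfK// gt_eqF.
  have H1 : e d - s * e v <= l * `|d| * `|d - s *: v|.
    rewrite -in_dualZ// -in_dualB// (le_trans (dual_le _ he))//.
    by rewrite ler_wpM2r.
  have H2 := sqr_ge0 (`|d| - `|d - s *: v|).
  have H3 : `|d - s *: v| ^+ 2 <= `|d| ^+ 2 - 2 * s * ip d v + s ^+ 2.
    rewrite normB_sqr (ipC d) ipZl (ipC v) mulrA lerD2l normrZ exprMn.
    by rewrite real_normK ?num_real// ler_piMr ?sqr_ge0// expr_le1.
  have H4 : l * `|d| * `|d - s *: v| <= l * (`|d| ^+ 2 - s * ip d v + s ^+ 2 / 2).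
    by rewrite -mulrA ler_pM2l//; nra.
  have := le_trans H1 H4; rewrite -(ler_pM2l l0) => H5.
  have gv := gE v.
  have ev : e v = g v + l * ip d v by rewrite gv subrK.
  rewrite ev in H5.
  have : l * (l * (s ^+ 2 / 2)) = (g v) ^+ 2 / 2.
    by transitivity ((l * s) ^+ 2 / 2); [field|rewrite ls sqrrN].
  have : l * (s * g v) = - (g v)^+2 by rewrite mulrA ls; ring.
  nra.
have rhs0 : 0 <= 2 * l * (l * `|d| ^+ 2 - e d).
  by have := key 0; rewrite normr0 in_dual0// expr0n/=; apply.
rewrite -[leRHS]sqr_sqrtr// ler_sqr ?nnegrE ?sqrtr_ge0 ?dual_norm_ge0//.
apply: dual_norm_le => v hv.
by rewrite -[leLHS]sqrtr_sqr ler_sqrt// key.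
Qed.

End Hilbert.

(** * Minimisation of strongly convex functions *)

Section Min.
Context {R : realType} {H : completeNormedModType R}.
Implicit Types (psi : H -> \bar R).

(** Serves twice: for the limit of a minimising sequence of a subproblem, and for
    the limit of the iterates. *)
Lemma lsc_sum_cvg_le psi (u : nat -> H) y (q r : nat -> R) q0 r0 :
  lower_semicontinuous psi -> u @ \oo --> y -> q @ \oo --> q0 ->
  r @ \oo --> r0 -> (forall n, (q n)%:E + psi (u n) <= (r n)%:E)%E ->
  (q0%:E + psi y <= r0%:E)%E.
Proof.
move=> lpsi uy qq rr le; rewrite leNgt; apply/negP => lt0.
have [a [ra apsi]] : exists a, r0 - q0 < a /\ (a%:E < psi y)%E.
  move: lt0; case: (psi y) => [p| |]//=.
    rewrite -EFinD lte_fin => h; exists ((r0 - q0 + p) / 2); rewrite lte_fin.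
    by split; lra.
  by move=> _; exists (r0 - q0 + 1); rewrite ltry ltrDl ltr01.
have [V Vy hV] := lpsi y a apsi.
have rqa : \forall n \near \oo, r n - q n < a.
  by apply: cvgr_lt ra; apply: cvgB.
have hVn : \forall n \near \oo, V (u n) by exact: uy.
have [n [h1 h2]] := filter_ex (filterI rqa hVn).
have := le n; have := hV _ h2.
case: (psi (u n)) => [p| |]//=; rewrite lte_fin -EFinD lee_fin; lra.
Qed.

Lemma cauchy_modulus_cvg (u : nat -> H) (b : nat -> R) :
  b @ \oo --> 0 -> (forall k n, (k <= n)%N -> `|u n - u k| <= b k) ->
  cvg (u @ \oo).
Proof.
move=> b0 hu; apply/cauchy_cvgP; apply: cauchy_exP => e e0.
have [k /= bk] : exists k, b k < e.
  have hb : \forall k \near \oo, b k < e by apply: cvgr_lt b0 _ _.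
  by have [k] := filter_ex hb; exists k.
exists (u k); exists k => // n /= kn.
by rewrite -ball_normE/= distrC (le_lt_trans (hu _ _ kn)).
Qed.

(** Two almost minimal points have an almost minimal midpoint, so the strong
    convexity gap c ||y - z||^2 makes minimising sequences Cauchy, and lower
    semicontinuity makes their limit a minimiser. *)
Lemma midconvex_min_exists (q : H -> R) psi (c lb : R) :
  continuous q -> lower_semicontinuous psi -> 0 < c ->
  (forall z, lb%:E <= (q z)%:E + psi z)%E ->
  (exists z, (q z)%:E + psi z < +oo)%E ->
  (forall y z a b, (q y)%:E + psi y <= a%:E -> (q z)%:E + psi z <= b%:E ->
     (q (2^-1 *: (y + z)))%:E + psi (2^-1 *: (y + z))
       <= ((a + b) / 2 - c * `|y - z| ^+ 2)%:E)%E ->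
  exists y, forall z, ((q y)%:E + psi y <= (q z)%:E + psi z)%E.
Proof.
move=> cq lpsi c0 hlb [z0 hz0] mid.
pose G z := ((q z)%:E + psi z)%E.
have Ilb : (lb%:E <= ereal_inf (range G))%E.
  by apply: le_ereal_inf_tmp => _ [z _ <-]; exact: hlb.
have Iub z : (ereal_inf (range G) <= G z)%E by apply: ereal_inf_lbound; exists z.
have If : ereal_inf (range G) \is a fin_num.
  by rewrite fin_numElt (lt_le_trans _ Ilb) ?ltNyr// (le_lt_trans (Iub z0)).
set r := fine (ereal_inf (range G)).
have rE : ereal_inf (range G) = r%:E by rewrite fineK.
have /choice [u hu] : forall n : nat, exists y, (G y <= (r + n.+1%:R^-1)%:E)%E.
  move=> n; have n0 : 0 < n.+1%:R^-1 :> R by rewrite invr_gt0.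
  have [_ [y _ <-]] := lb_ereal_inf_adherent n0 If.
  by rewrite rE -EFinD => h; exists y; exact: ltW.
have cau k n : (k <= n)%N -> `|u n - u k| <= Num.sqrt (c^-1 * k.+1%:R^-1).
  move=> kn; have := mid _ _ _ _ (hu n) (hu k).
  move/(le_trans (Iub _)); rewrite rE lee_fin => h.
  have nk : n.+1%:R^-1 <= k.+1%:R^-1 :> R by rewrite lef_pV2 ?posrE// ler_nat.
  have k0 : 0 <= c^-1 * k.+1%:R^-1 by rewrite mulr_ge0 ?invr_ge0 ?ltW.
  rewrite -[leLHS]normr_id -sqrtr_sqr ler_sqrt// ler_pdivlMl//.
  by move: h nk; set A := n.+1%:R^-1; set B := k.+1%:R^-1; lra.
have b0 : Num.sqrt (c^-1 * k.+1%:R^-1) @[k --> \oo] --> (0 : R).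
  rewrite -[X in _ --> X]sqrtr0; apply: (continuous_cvg _ (@sqrt_continuous _ _)).
  by rewrite -[X in _ --> X](mulr0 c^-1); apply: cvgMr; exact: cvg_harmonic.
have /cvg_ex [y uy] := cauchy_modulus_cvg b0 cau.
exists y => z; apply: le_trans (Iub z); rewrite rE.
apply: (@lsc_sum_cvg_le psi u y (q \o u) (fun n => r + n.+1%:R^-1)) => //.
  by apply: continuous_cvg => //; exact: cq.
rewrite -[X in _ --> X]addr0; apply: cvgD; [exact: cvg_cst|exact: cvg_harmonic].
Qed.

End Min.

(** * Convexity and solvability of the regularised subproblem *)

Section Convex.
Context {R : realType} {H : completeNormedModType R}.
Implicit Types (psi G : H -> \bar R) (u v w y z : H).

Lemma convex_on_le D G y z (t a b : R) : convex_on D G -> D y -> D z ->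
  0 <= t <= 1 -> (G y <= a%:E)%E -> (G z <= b%:E)%E ->
  (G (t *: y + (1 - t) *: z)%R <= (t * a + (1 - t) * b)%:E)%E.
Proof.
move=> cG Dy Dz t01 ya zb; apply: (le_trans (cG _ _ _ Dy Dz t01)).
by rewrite [leRHS]EFinD !EFinM leeD// lee_wpmul2l// lee_fin; lra.
Qed.

Lemma le_of_small_multiple (a b : R) :
  (forall t : R, 0 < t <= 1 -> a <= t * b) -> a <= 0.
Proof.
move=> h; rewrite leNgt; apply/negP => a0.
have ab := h 1 ltac:(lra); rewrite mul1r in ab.
have b0 : 0 < b by lra.
have := h (a / (2 * b)); rewrite divr_gt0 ?mulr_gt0//= ler_pdivrMr ?mulr_gt0//.
have -> : a / (2 * b) * b = a / 2 by field; rewrite gt_eqF.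
by move=> /(_ ltac:(lra)); lra.
Qed.

Lemma subdiff_le psi y z p (a b : R) : subdiff psi y p ->
  psi y = a%:E -> psi z = b%:E -> a + p (z - y) <= b.
Proof. by move=> [_ hp] ya zb; have := hp z; rewrite ya zb -EFinD lee_fin. Qed.

Lemma subdiff_in_dual psi y p : subdiff psi y p -> in_dual p.
Proof. by case. Qed.

Lemma subdiff_finite psi y p : proper psi -> subdiff psi y p ->
  psi y \is a fin_num.
Proof.
move=> [pN [z pz]] [_ /(_ z)].
have := pN y; case: (psi y) => [a| |]//= _.
by move=> h; have := le_lt_trans h pz.
Qed.

(** Comparing y with y + t (z - y) and using convexity of psi only, the minimality
    inequality divided by t reads - l(z - y) - t Q(z - y) <= psi z - psi y; the
    quadratic term disappears as t -> 0. *)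
Lemma quadratic_min_subdiff (q Q : H -> R) psi (l : H -> R^o) y :
  convex_on setT psi -> proper psi -> psi y \is a fin_num -> in_dual l ->
  (forall w t, q (y + t *: w) = q y + t * l w + t ^+ 2 * Q w) ->
  (forall z, (q y)%:E + psi y <= (q z)%:E + psi z)%E ->
  subdiff psi y (- l).
Proof.
move=> cp [pN _] fy hl hq hmin; split; first exact: in_dual_opp.
move=> z; have pzN := pN z.
case pz: (psi z) pzN => [b| |]// _; last by rewrite leey.
rewrite -[psi y]fineK// -EFinD lee_fin -subr_le0; set a := fine _.
have ya : psi y = a%:E by rewrite fineK.
apply: (@le_of_small_multiple _ (Q (z - y))) => t t01.
have t0 : 0 < t by lra.
have := hmin (y + t *: (z - y)).
have -> : psi (y + t *: (z - y)) = psi (t *: z + (1 - t) *: y).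
  by congr psi; rewrite scalerBr scalerBl scale1r addrCA addrA addrC !addrA.
have := @convex_on_le setT psi z y t b a cp I I ltac:(lra).
rewrite pz ya => /(_ (lexx _) (lexx _)).
case: (psi _) => [s| |]//=; rewrite -?EFinD !lee_fin hq fctE => h1 h2.
rewrite -(ler_pM2l t0); nra.
Qed.

End Convex.

Section Quadratic.
Context {R : realType} {H : completeNormedModType R}.
Variable (A : H -> H -> R^o).
Hypothesis hA : sym_bounded_op A.
Implicit Types (u v w y z : H).

Lemma sboDl u v w : A (u + v) w = A u w + A v w.
Proof.
by have /(congr1 (fun g => g w)) := sbo_linear hA 1 u v; rewrite !scale1r !fctE.
Qed.

Lemma sboDr u v w : A u (v + w) = A u v + A u w.
Proof. by rewrite in_dualD//; exact: sbo_dual. Qed.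

Lemma sboZr a u v : A u (a *: v) = a * A u v.
Proof. by rewrite in_dualZ//; exact: sbo_dual. Qed.

Lemma sboZl a u v : A (a *: u) v = a * A u v.
Proof. by rewrite (sbo_sym hA) sboZr (sbo_sym hA). Qed.

Lemma sboNl u v : A (- u) v = - A u v.
Proof. by rewrite -scaleN1r sboZl mulN1r. Qed.

Lemma sboNr u v : A u (- v) = - A u v.
Proof. by rewrite -scaleN1r sboZr mulN1r. Qed.

Lemma sboBl u v w : A (u - v) w = A u w - A v w.
Proof. by rewrite sboDl sboNl. Qed.

Lemma sboBr u v w : A u (v - w) = A u v - A u w.
Proof. by rewrite sboDr sboNr. Qed.

(** The bound on A controls the second-order term of the expansion around y, which
    suffices since A y is continuous. *)
Lemma sbo_quad_continuous : continuous (fun z => A z z : R).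
Proof.
move=> y.
have -> : (fun z => A z z : R) =
    (fun z => A y y + 2 * (A y z - A y y) + A (z - y) (z - y)).
  apply/funext => z; rewrite sboBl !sboBr (sbo_sym hA z y); ring.
have [C hC] := sbo_bounded hA.
have c1 : (A y z : R) @[z --> y] --> (A y y : R).
  exact: (sbo_dual hA y).2.
have c2 : (A (z - y) (z - y) : R) @[z --> y] --> (A (y - y) (y - y) : R).
  rewrite subrr (_ : A 0 0 = 0); last by rewrite in_dual0//; exact: sbo_dual.
  apply: norm_cvg0.
  apply: (@squeeze_cvgr _ _ _ _ (cst 0) (fun z => C * (`|z - y| * `|z - y|))).
  - near=> z; rewrite /cst normr_ge0/= mulrA.
    rewrite (le_trans (dual_norm_bound _ (sbo_dual hA _)))// ler_wpM2r//.
  - exact: cvg_cst.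
  - rewrite -[X in _ --> X](mulr0 C); apply: cvgMr.
    rewrite -[X in _ --> X](mulr0 0).
    have : `|z - y| @[z --> y] --> (0 : R).
      rewrite -(normr0 H) -(subrr y); apply: cvg_norm; apply: cvgB => //.
      exact: cvg_cst.
    by move=> h; apply: cvgM.
apply: cvgD => //; apply: cvgD; first exact: cvg_cst.
by apply: cvgMr; apply: cvgB => //; exact: cvg_cst.
Unshelve. all: by end_near. Qed.

End Quadratic.

Section Subproblem.
Context {R : realType} {H : completeNormedModType R} (ip : {dot H for idfun}).
Hypothesis hip : hilbert ip.

(** The subproblem assumption only covers large parameters, whereas the trial
    parameters lam_k / 2 tend to 0; for those, positive semidefiniteness makes the
    model strongly convex. *)
Lemma psd_admissible_exists (f : H -> R^o) psi (B : H -> H -> H -> R^o) x p0 (lam : R) :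
  in_dual (fder f x) -> proper psi -> convex_on setT psi ->
  lower_semicontinuous psi -> subdiff psi x p0 -> sym_bounded_op (B x) ->
  psd (B x) -> 0 < lam -> exists y, admissible ip f psi B x lam y.
Proof.
move=> hf pp cp lp hp0 hB hpsd l0.
have px := subdiff_finite pp hp0; set a := fine (psi x).
have xa : psi x = a%:E by rewrite fineK.
pose q z : R := f x + fder f x (z - x) + 2^-1 * B x (z - x) (z - x)
    + lam / 2 * `|z - x| ^+ 2.
have cq : continuous q.
  move=> z; have cz : (w - x) @[w --> z] --> z - x by apply: cvgB => //; exact: cvg_cst.
  apply: cvgD; last first.
    apply: cvgMr; have cn := @exprn_continuous R 2 `|z - x|.
    exact: (cvg_comp _ _ (cvg_norm cz) cn).
  apply: cvgD; last first.
    apply: cvgMr; have cn := @sbo_quad_continuous _ _ _ hB (z - x).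
    exact: (cvg_comp _ _ cz cn).
  apply: cvgD; first exact: cvg_cst.
  exact: (cvg_comp _ _ cz (hf.2 (z - x))).
have hg := in_dual_add hf (subdiff_in_dual hp0).
set g := (_ + _) in hg.
have [y hy] : exists y, forall z, ((q y)%:E + psi y <= (q z)%:E + psi z)%E.
  apply: (@midconvex_min_exists _ _ q psi (lam / 8)
     (f x + a - dual_norm g ^+ 2 / (2 * lam))) => //.
  - by rewrite divr_gt0.
  (* The subgradient p0 bounds psi below by an affine map, which the quadratic
     term dominates. *)
  - move=> z; have := pp.1 z; case pz: (psi z) => [b| |]// _; last by rewrite addey// leey.
    have := subdiff_le hp0 xa pz.
    rewrite -EFinD lee_fin /q.
    have := hpsd (z - x).
    have : - (dual_norm g * `|z - x|) <= g (z - x).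
      by have := dual_norm_bound (z - x) hg; rewrite ler_norml => /andP[].
    have -> : g (z - x) = fder f x (z - x) + p0 (z - x) by [].
    have : - (dual_norm g ^+ 2 / (2 * lam)) <=
           lam / 2 * `|z - x| ^+ 2 - dual_norm g * `|z - x|.
      have := sqr_ge0 (lam * `|z - x| - dual_norm g).
      have l2 : 0 < 2 * lam by rewrite mulr_gt0.
      rewrite lerNl ler_pdivlMr//; nra.
    lra.
  - by exists x; rewrite xa -EFinD ltry.
  - move=> y z b1 b2 h1 h2.
    have h1' : (psi y <= (b1 - q y)%:E)%E by rewrite EFinB leeBrDl.
    have h2' : (psi z <= (b2 - q z)%:E)%E by rewrite EFinB leeBrDl.
    have := @convex_on_le _ _ setT psi y z 2^-1 _ _ cp I I ltac:(lra) h1' h2'.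
    have -> : 2^-1 *: y + (1 - 2^-1) *: z = 2^-1 *: (y + z).
      by rewrite scalerDr; congr (_ + _ *: _); lra.
    set w := 2^-1 *: (y + z).
    (* The parallelogram identities of the two quadratic terms; only the one of
       the norm is kept, the other has a sign. *)
    have qw : q w = (q y + q z) / 2 - 8^-1 * B x (y - z) (y - z)
               - lam / 8 * `|y - z| ^+ 2.
      have wE : w - x = 2^-1 *: ((y - x) + (z - x)).
        rewrite addrACA -opprD scalerBr; congr (_ - _).
        by rewrite -mulr2n -[x *+ 2]scaler_nat scalerA mulVf// scale1r.
      have yzE : y - z = (y - x) - (z - x) by rewrite opprB addrA subrK.
      rewrite /q wE yzE; move: (y - x) (z - x) => u v.
      rewrite normrZ exprMn (normD_sqr hip) (normB_sqr hip).
      rewrite (sboZl hB) (sboZr hB) !(sboDl hB, sboDr hB, sboNl hB, sboNr hB).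
      rewrite (in_dualZ _ _ hf) (in_dualD _ _ hf) (sbo_sym hB v u) ger0_norm//; by field.
    case: (psi w) => [s| |].
    - rewrite -EFinD !lee_fin => h.
      by have := hpsd (y - z); rewrite qw; lra.
    - by rewrite leye_eq.
    - by move=> _; rewrite addeNy leNye.
have py : psi y \is a fin_num.
  have := hy x; have := pp.1 y; rewrite xa.
  by case: (psi y).
exists y; split; last by have := hy x.
have -> : psi_der ip f B x lam y = - (fder f x + B x (y - x) + lam *: riesz ip (y - x)).
  by rewrite /psi_der !opprD.
apply: (@quadratic_min_subdiff _ _ q
  (fun w => 2^-1 * B x w w + lam / 2 * `|w| ^+ 2)) => //.
  apply: in_dual_add; first by apply: in_dual_add => //; exact: sbo_dual.
  by apply: in_dual_scale; exact: in_dual_riesz.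
move=> w t; rewrite /q !fctE (_ : y + t *: w - x = y - x + t *: w); last by rewrite addrAC.
move: (y - x) => u.
rewrite (normD_sqr hip) !(sboDl hB, sboDr hB, sboZl hB, sboZr hB).
rewrite (in_dualD _ _ hf) (in_dualZ _ _ hf) (sbo_sym hB w u).
rewrite normrZ exprMn real_normK ?num_real//.
rewrite (ipC _ u) (ipZl _ t) /riesz (ipC _ w) /GRing.scale/=; by field.
Qed.

End Subproblem.

(** * Differentiable functions along segments *)

Section Smooth.
Context {R : realType} {H : completeNormedModType R}.
Implicit Types (f : H -> R^o) (x y z d : H).

Lemma in_dual_fder f x : differentiable f x -> in_dual (fder f x).
Proof.
move=> df; split; first by move=> a u v; rewrite /fder linearP.
by move=> z; exact: (diff_continuous df).
Qed.

Lemma fder_quotient_cvg f y w : differentiable f y ->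
  (t^-1 * (f (t *: w + y) - f y)) @[t --> (0 : R)^'] --> (fder f y w : R).
Proof. by move=> df; rewrite /fder -deriveE//; exact: diff_derivable. Qed.

(** On the segment from y to z, local convexity of F and the global subgradient
    inequality for psi bound the difference quotients of f at y from above. *)
Lemma local_convex_subgradient f psi c r y z p (a b : R) :
  convex_on (ball c r) (objective f psi) -> ball c r y -> ball c r z ->
  differentiable f y -> subdiff psi y p -> psi y = a%:E -> psi z = b%:E ->
  f y + a + (fder f y + p) (z - y) <= f z + b.
Proof.
move=> cF By Bz df hp ya zb; rewrite leNgt; apply/negP => lt0.
pose w := z - y; have hpd := subdiff_in_dual hp.
have lt1 : f z + b - (f y + a) - p w < fder f y w.
  by move: lt0; rewrite fctE -/w; lra.
have hr : \forall t \near (0 : R)^'+,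
    f z + b - (f y + a) - p w < t^-1 * (f (t *: w + y) - f y).
  exact: cvgr_gt (cvg_dnbhs_at_right (fder_quotient_cvg (w := w) df)) _ lt1.
have h1 : \forall t \near (0 : R)^'+, t < 1 by exact: nbhs_right_lt.
have h0 : \forall t \near (0 : R)^'+, 0 < t by exact: nbhs_right_gt.
have [t [[h t1] t0]] := filter_ex (filterI (filterI hr h1) h0).
have Fy : (objective f psi y <= (f y + a)%:E)%E by rewrite /objective ya -EFinD.
have Fz : (objective f psi z <= (f z + b)%:E)%E by rewrite /objective zb -EFinD.
have := convex_on_le (t := t) cF Bz By ltac:(lra) Fz Fy.
have -> : t *: z + (1 - t) *: y = t *: w + y.
  by rewrite /w scalerBr scalerBl scale1r -addrA [- _ + y]addrC.
have := hp.2 (t *: w + y); rewrite addrK in_dualZ// ya -EFinD.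
move=> hle; rewrite /objective => hF.
have := le_trans (leeD2l (f (t *: w + y))%:E hle) hF.
rewrite -EFinD lee_fin => hh.
by move: h; rewrite mulrC ltr_pdivlMr//; nra.
Qed.

Lemma is_derive_along_line f x d (t : R) : differentiable f (x + t *: d) ->
  is_derive t 1 (fun s : R => f (x + s *: d)) (fder f (x + t *: d) d).
Proof.
move=> df; have hd := diff_derivable (v := d) df.
have E : (fun h : R => h^-1 *: (f (x + (h *: (1 : R) + t) *: d) - f (x + t *: d))) =
         (fun h : R => h^-1 *: (f (h *: d + (x + t *: d)) - f (x + t *: d))).
  apply/funext => h; congr (_ *: (f _ - _)).
  by rewrite [h *: 1]mulr1 scalerDl addrCA.
apply: DeriveDef; first by rewrite /derivable E; exact: hd.
by rewrite /derive E -[X in X @ _]E; rewrite /fder -deriveE// /derive E.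
Qed.

(** The mean value theorem for t |-> f(x + t d) - t f'(x) d - t^2 c2, where c2 is
    chosen so that the residual bound at x makes the derivative nonpositive. Keeping
    A at the base point x preserves the constant L / 2. *)
Lemma quadratic_upper_bound f (A : H -> H -> R^o) (L : R) x d :
  (forall z, differentiable f z) -> sym_bounded_op A ->
  (forall y, dual_norm (fder f y - fder f x - A (y - x)) <= L * `|x - y|) ->
  f (x + d) <= f x + fder f x d + 2^-1 * A d d + L / 2 * `|d| ^+ 2.
Proof.
move=> df hA hb.
pose c1 : R := fder f x d; pose c2 : R := 2^-1 * A d d + L / 2 * `|d| ^+ 2.
pose phi (t : R) : R := f (x + t *: d) - (t * c1 + t ^+ 2 * c2).
pose dphi (t : R) : R := fder f (x + t *: d) d - (c1 + 2 * t * c2).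
have dphiE (t : R) : is_derive t (1 : R) phi (dphi t).
  have h1 := is_derive_along_line (df (x + t *: d)).
  have h2 : is_derive t (1 : R) (fun t : R => t * c1 + t ^+ 2 * c2) (c1 + 2 * t * c2).
    apply: is_derive_eq; rewrite /GRing.scale/=; ring.
  exact: is_deriveB.
have [c cin] : exists2 c, c \in `]0, 1[%R & phi 1 - phi 0 = dphi c * (1 - 0).
  apply: MVT => // ; apply: derivable_within_continuous => t _.
  by have [] := dphiE t.
rewrite /phi /dphi !scale0r !addr0 scale1r subr0 mulr1 => h.
have [c0 c1'] : 0 < c /\ c < 1 by move: cin; rewrite in_itv/= => /andP[].
have hg : in_dual (fder f (x + c *: d) - fder f x - A (x + c *: d - x)).
  by apply: in_dual_sub; [apply: in_dual_sub; exact: in_dual_fder|exact: sbo_dual].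
have h2 : dual_norm (fder f (x + c *: d) - fder f x - A (x + c *: d - x)) * `|d|
   <= L * c * `|d| ^+ 2.
  rewrite expr2 mulrA ler_wpM2r// (le_trans (hb _))// opprD addNKr normrN normrZ.
  by rewrite gtr0_norm// mulrA.
have xE : x + c *: d - x = c *: d by rewrite addrC addrA addNr add0r.
have := le_trans (dual_le d hg) h2; rewrite xE !fctE (sboZl hA).
move: h; rewrite /c1 /c2 expr1n expr0n/=. lra.
Qed.


End Smooth.

(** * A single step: acceptance tests and dependence on the parameter *)

(** The bound imposed on beta is exactly what makes m L the threshold. *)
Lemma decrease_threshold (R : realType) (m beta L lam : R) : 1 <= m ->
  beta <= (m - 1) / (2 * m) -> m * L <= lam -> 0 < lam ->
  beta * lam <= (lam - L) / 2.
Proof.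
move=> m1; have m0 : 0 < m by lra.
rewrite ler_pdivlMr ?mulr_gt0// => h lm l0.
have h2 : beta * (2 * m) * lam <= (m - 1) * lam by rewrite ler_wpM2r// ltW.
have : 2 * (beta * lam) * m <= (lam - L) * m by lra.
rewrite ler_pM2r//; lra.
Qed.

Section Step.
Context {R : realType} {H : completeNormedModType R} (ip : {dot H for idfun}).
Hypothesis hip : hilbert ip.
Variables (f : H -> R^o) (psi : H -> \bar R) (B : H -> H -> H -> R^o).
Hypothesis df : forall z, differentiable f z.
Hypothesis hB : forall z, sym_bounded_op (B z).
Hypothesis pp : proper psi.

(** The part of F'(y) that the model does not see: F'(y) is the residual minus
    lam R(y - x). Both acceptance tests are consequences of its smallness. *)
Definition newton_residual (x y : H) : H -> R^o :=
  fder f y - fder f x - B x (y - x).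

Lemma in_dual_residual x y : in_dual (newton_residual x y).
Proof.
apply: in_dual_sub; last exact: sbo_dual.
by apply: in_dual_sub; exact: in_dual_fder.
Qed.

Lemma obj_derE x lam y : obj_der ip f B x lam y =
  newton_residual x y - lam *: riesz ip (y - x).
Proof. by rewrite /obj_der /psi_der /newton_residual !addrA. Qed.

Lemma in_dual_obj_der x lam y : in_dual (obj_der ip f B x lam y).
Proof.
rewrite obj_derE; apply: in_dual_sub; first exact: in_dual_residual.
by apply: in_dual_scale; exact: in_dual_riesz.
Qed.

Lemma obj_der_step x lam y : obj_der ip f B x lam y (x - y) =
  lam * `|y - x| ^+ 2 - newton_residual x y (y - x).
Proof.
rewrite -(opprB y x) (in_dualN _ (in_dual_obj_der _ _ _)) obj_derE !fctE.
by rewrite /riesz hip opprB.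
Qed.

Lemma gradient_test_of_small_residual (alpha lam : R) x y : alpha <= 2^-1 -> 0 < lam ->
  dual_norm (newton_residual x y) <= lam * `|y - x| ->
  alpha / lam * dual_norm (obj_der ip f B x lam y) ^+ 2
    <= obj_der ip f B x lam y (x - y).
Proof.
move=> a2 l0 hr; rewrite obj_der_step obj_derE.
have := riesz_perturbation_cocoercive hip (in_dual_residual x y) l0 hr.
set g := dual_norm _ ^+ 2; set b := (_ - _ : R) => h.
have g0 : 0 <= g by exact: sqr_ge0.
have h1 : alpha * g <= lam * b by nra.
by rewrite mulrAC ler_pdivrMr// mulrC [b * _]mulrC (mulrC g).
Qed.

(** The decrease of the model cancels the quadratic form, whatever its sign, in the
    upper bound for f, leaving (lam - L) / 2 times the squared step. *)
Lemma decrease_test_of_large_parameter (m beta L lam a b : R) x y :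
  1 <= m -> beta <= (m - 1) / (2 * m) -> m * L <= lam -> 0 < lam ->
  (forall z, dual_norm (newton_residual x z) <= L * `|x - z|) ->
  psi x = a%:E -> psi y = b%:E -> admissible ip f psi B x lam y ->
  ((beta * lam * `|y - x| ^+ 2)%:E <= objective f psi x - objective f psi y)%E.
Proof.
move=> m1 bm lm l0 hr xa yb [_].
rewrite /model /objective xa yb -!EFinD !lee_fin => hD.
have := quadratic_upper_bound (y - x) df (hB x) hr.
rewrite [x + _]addrC subrK => hq.
have hth : beta * lam * `|y - x| ^+ 2 <= (lam - L) / 2 * `|y - x| ^+ 2.
  by rewrite ler_wpM2r ?sqr_ge0// (decrease_threshold m1).
move: hD; rewrite subrr normr0 (in_dual0 (in_dual_fder (df x))).
rewrite (in_dual0 (sbo_dual (hB x) 0)) expr0n/= !mulr0 !addr0.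
lra.
Qed.

(** Convexity gives F(x) - F(y) >= <F'(y), x - y>, which is lam times the squared
    step up to the residual. The upper bound on f used for large parameters would
    only do for lam above a multiple of L. *)
Lemma decrease_test_of_local_convexity (beta r lam a b : R) c x y :
  convex_on (ball c r) (objective f psi) -> ball c r x -> ball c r y ->
  beta <= 2^-1 -> 0 < lam ->
  dual_norm (newton_residual x y) <= lam / 2 * `|y - x| ->
  psi x = a%:E -> psi y = b%:E -> subdiff psi y (psi_der ip f B x lam y) ->
  ((beta * lam * `|y - x| ^+ 2)%:E <= objective f psi x - objective f psi y)%E.
Proof.
move=> cF Bx By b2 l0 hr xa yb hp.
have := local_convex_subgradient cF By Bx (df y) hp yb xa.
rewrite -/(obj_der ip f B x lam y) obj_der_step => h1.
rewrite /objective xa yb -!EFinD lee_fin.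
have h2 := le_trans (dual_le (y - x) (in_dual_residual x y)) (ler_wpM2r (normr_ge0 _) hr).
have : beta * lam * `|y - x| ^+ 2 <= 2^-1 * lam * `|y - x| ^+ 2.
  by rewrite ler_wpM2r ?sqr_ge0// ler_wpM2r// ltW.
by move: h1 h2; rewrite expr2; lra.
Qed.

(** Monotonicity of the subdifferential at the two points, with the psd term dropped,
    yields (n1 - n2) (l1 n1 - l2 n2) <= 0 for the step lengths n1, n2; as l2 < l1 the
    factors have different signs only in the stated range. *)
Lemma prox_step_antimonotone (l1 l2 : R) x y1 y2 : psd (B x) -> 0 < l2 -> l2 < l1 ->
  subdiff psi y1 (psi_der ip f B x l1 y1) ->
  subdiff psi y2 (psi_der ip f B x l2 y2) ->
  `|y1 - x| <= `|y2 - x| /\ l2 * `|y2 - x| <= l1 * `|y1 - x|.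
Proof.
move=> hpsd l20 l21 h1 h2.
have f1 := subdiff_finite pp h1; have f2 := subdiff_finite pp h2.
have m1 := subdiff_le h1 (esym (fineK f1)) (esym (fineK f2)).
have m2 := subdiff_le h2 (esym (fineK f2)) (esym (fineK f1)).
have : psi_der ip f B x l1 y1 (y2 - y1) + psi_der ip f B x l2 y2 (y1 - y2) <= 0 by lra.
have -> : y2 - y1 = (y2 - x) - (y1 - x) by rewrite opprB addrA subrK.
have -> : y1 - y2 = (y1 - x) - (y2 - x) by rewrite opprB addrA subrK.
rewrite /psi_der !fctE.
have := hpsd ((y1 - x) - (y2 - x)).
have := ip_cauchy_schwarz hip (y1 - x) (y2 - x).
move: (y1 - x) (y2 - x) => u v.
have hf := in_dual_fder (df x).
rewrite ler_norml => /andP[_ cs].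
rewrite !(sboDl (hB x), sboDr (hB x), sboNl (hB x), sboNr (hB x)).
rewrite !(in_dualB _ _ hf) (sbo_sym (hB x) v u) /riesz.
rewrite !ipBr !hip (ipC ip v u) /GRing.scale/= => hA hm.
have key : (`|u| - `|v|) * (l1 * `|u| - l2 * `|v|) <= 0.
  have : (l1 + l2) * ip u v <= (l1 + l2) * (`|u| * `|v|) by rewrite ler_wpM2l//; lra.
  lra.
have u0 := normr_ge0 u; have v0 := normr_ge0 v.
have uv : l2 * `|u| <= l1 * `|u| by rewrite ler_wpM2r// ltW.
split; rewrite leNgt; apply/negP => hlt.
  have : l2 * `|v| < l2 * `|u| by rewrite ltr_pM2l.
  move=> h; have : 0 < (`|u| - `|v|) * (l1 * `|u| - l2 * `|v|).
    by apply: mulr_gt0; lra.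
  lra.
have : l2 * `|u| < l2 * `|v| by lra.
rewrite ltr_pM2l// => h.
have : 0 < (`|v| - `|u|) * (l2 * `|v| - l1 * `|u|) by apply: mulr_gt0; lra.
lra.
Qed.

End Step.

(** * From one-step estimates to superlinear rates *)

Lemma le_sqrt_mul (R : realType) (K u v : R) : 0 <= K -> 0 <= u -> 0 <= v ->
  u ^+ 2 <= K * v ^+ 2 -> u <= Num.sqrt K * v.
Proof.
move=> K0 u0 v0 h; rewrite -ler_sqr ?nnegrE ?mulr_ge0 ?sqrtr_ge0//.
by rewrite exprMn sqr_sqrtr.
Qed.

Section Rate.
Context {R : realType} {H : completeNormedModType R}.
Variables (x : nat -> H) (delta g lam : nat -> R) (a b mu Lmax : R).
Local Notation t k := `|x k.+1 - x k|.
Hypotheses (a0 : 0 < a) (b0 : 0 < b) (mu0 : 0 < mu).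
Hypothesis lam0 : forall k, 0 < lam k.
Hypothesis delta0 : forall k, 0 <= delta k.
Hypothesis g0 : forall k, 0 <= g k.
Hypothesis sufficient_decrease : forall k,
  b * lam k * t k ^+ 2 <= delta k - delta k.+1.
Hypothesis gradient_bound : forall k, a * g k.+1 <= lam k * t k.
Hypothesis gradient_dominated : forall k, 2 * mu * delta k <= g k ^+ 2.
Hypothesis lam_halving : forall k, lam k <= 2 * lam k.+1.
Hypothesis lam_bounded : forall k, lam k <= Lmax.

(** rho is the contraction factor of the square roots s of the gaps, C bounds a step
    by the square root of the previous gap, and M is C times the sum of the
    geometric series of ratio rho. *)
Let c := 2 * mu * a ^+ 2 * b.
Let s k := Num.sqrt (delta k).
Let rho := Num.sqrt (Lmax / (c + Lmax)).
Let C := Num.sqrt (2 / (c * b)).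
Let M := C / (1 - rho).

Let c0 : 0 < c. Proof. by rewrite !mulr_gt0// exprn_gt0. Qed.
Let Lmax0 : 0 < Lmax. Proof. exact: lt_le_trans (lam0 0) (lam_bounded 0). Qed.

Lemma gap_le_step k : 2 * mu * a ^+ 2 * delta k.+1 <= lam k ^+ 2 * t k ^+ 2.
Proof.
have h : (a * g k.+1) ^+ 2 <= (lam k * t k) ^+ 2.
  by rewrite ler_sqr ?nnegrE// mulr_ge0// ltW.
rewrite !exprMn in h; apply: le_trans h.
rewrite mulrAC [leLHS]mulrC ler_wpM2l ?sqr_ge0//.
Qed.

(** The gradient bound and gradient domination give delta_(k+1) = O(lam_k^2 t_k^2),
    and sufficient decrease trades lam_k t_k^2 for the decrease of the gap. *)
Lemma gap_step k : c * delta k.+1 <= lam k * (delta k - delta k.+1).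
Proof.
have h1 := gap_le_step k; have h2 := sufficient_decrease k.
apply: (@le_trans _ _ (lam k * (b * lam k * t k ^+ 2))).
  have := ler_wpM2r (ltW b0) h1; rewrite /c; lra.
by rewrite ler_wpM2l// ltW.
Qed.

Lemma gap_contraction k : c * delta k.+1 <= lam k * delta k.
Proof.
apply: (le_trans (gap_step k)); rewrite ler_wpM2l ?(ltW (lam0 k))//.
by rewrite lerBlDr lerDl.
Qed.

Lemma rho_bound : 0 <= rho < 1.
Proof.
rewrite sqrtr_ge0/= -[ltRHS]sqrtr1 ltr_sqrt// ltr_pdivrMr ?addr_gt0// mul1r.
by rewrite ltrDr.
Qed.

Lemma sqrt_gap_contraction k : s k.+1 <= rho * s k.
Proof.
apply: le_sqrt_mul; rewrite ?sqrtr_ge0//; first by rewrite divr_ge0// ltW// addr_gt0.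
rewrite !sqr_sqrtr// mulrAC ler_pdivlMr ?addr_gt0//.
have h := gap_step k.
have h2 : 0 <= delta k - delta k.+1.
  by apply: le_trans (sufficient_decrease k); rewrite !mulr_ge0 ?sqr_ge0// ltW.
have : lam k * (delta k - delta k.+1) <= Lmax * (delta k - delta k.+1).
  by rewrite ler_wpM2r.
lra.
Qed.

(** Sufficient decrease alone would leave a factor 1 / lam_(k+1). It is absorbed by
    going back one iteration: delta_(k+1) carries the factor lam_k <= 2 lam_(k+1). *)
Lemma step_le_sqrt_gap k : t k.+1 <= C * s k.
Proof.
apply: le_sqrt_mul; rewrite ?sqrtr_ge0//; first by rewrite divr_ge0// ltW// mulr_gt0.
rewrite sqr_sqrtr// mulrAC ler_pdivlMr ?mulr_gt0//.
have h1 : b * lam k.+1 * t k.+1 ^+ 2 <= delta k.+1.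
  by apply: (le_trans (sufficient_decrease _)); rewrite lerBlDr lerDl.
have h2 := gap_contraction k.
have h3 : lam k * delta k <= 2 * lam k.+1 * delta k by rewrite ler_wpM2r.
have h4 := ler_wpM2l (ltW c0) h1.
rewrite -(ler_pM2l (lam0 k.+1)); lra.
Qed.

(** Geometric decay of s written as a telescoping bound, so that the lengths of
    consecutive steps can be summed. *)
Lemma step_telescope k : t k.+1 <= M * (s k - s k.+1).
Proof.
have /andP[_ r1] := rho_bound; have r1' : 0 < 1 - rho by rewrite subr_gt0.
apply: (le_trans (step_le_sqrt_gap k)); rewrite /M mulrAC ler_pdivlMr// -mulrA.
rewrite ler_wpM2l ?sqrtr_ge0//; have := sqrt_gap_contraction k; lra.
Qed.

Lemma M_ge0 : 0 <= M.
Proof.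
by have /andP[_ r1] := rho_bound; rewrite divr_ge0 ?sqrtr_ge0// subr_ge0 ltW.
Qed.

Lemma distance_le_sqrt_gap k n : (k <= n)%N -> `|x n.+1 - x k.+1| <= M * s k.
Proof.
move=> kn; have : `|x n.+1 - x k.+1| <= M * (s k - s n).
  elim: n kn => [|n IH]; first by rewrite leqn0 => /eqP ->; rewrite !subrr normr0 mulr0.
  rewrite leq_eqVlt => /predU1P[->|]; first by rewrite !subrr normr0 mulr0.
  rewrite ltnS => /IH h; have := step_telescope n.
  have := ler_normD (x n.+2 - x n.+1) (x n.+1 - x k.+1); rewrite addrA subrK.
  lra.
move/le_trans; apply; rewrite ler_wpM2l ?M_ge0// lerBlDr lerDl; exact: sqrtr_ge0.
Qed.

Lemma sqrt_gap_cvg0 : s @ \oo --> (0 : R).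
Proof.
have /andP[r0 r1] := rho_bound.
have hs k : s k <= s 0 * rho ^+ k.
  elim: k => [|k IH]; first by rewrite expr0 mulr1.
  rewrite (le_trans (sqrt_gap_contraction k))// exprS mulrCA.
  by rewrite ler_wpM2l.
apply: (@squeeze_cvgr _ _ _ _ (cst 0) (fun k => s 0 * rho ^+ k)).
- by near=> k; rewrite /cst sqrtr_ge0 hs.
- exact: cvg_cst.
- rewrite -[X in _ --> X](mulr0 (s 0)); apply: cvgMr; apply: cvg_expr.
  by rewrite ger0_norm.
Unshelve. all: by end_near. Qed.

Lemma gap_cvg0 : delta @ \oo --> (0 : R).
Proof.
have -> : delta = (fun k => s k * s k).
  by apply/funext => k; rewrite -expr2 sqr_sqrtr.
by rewrite -[X in _ --> X](mulr0 0); apply: cvgM; exact: sqrt_gap_cvg0.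
Qed.

Lemma iterates_cvg : cvg (x @ \oo).
Proof.
have bc : (fun k => M * s k) @ \oo --> (0 : R).
  by rewrite -[X in _ --> X](mulr0 M); apply: cvgMr; exact: sqrt_gap_cvg0.
have /cvg_ex[z hz] := @cauchy_modulus_cvg _ _ (fun k => x k.+1) _ bc distance_le_sqrt_gap.
by apply/cvg_ex; exists z; rewrite -(cvg_shiftS x).
Qed.

Variable z : H.
Hypothesis xz : x @ \oo --> z.

Lemma distance_limit_le k : `|x k.+1 - z| <= M * s k.
Proof.
have h : `|x n.+1 - x k.+1| @[n --> \oo] --> `|z - x k.+1|.
  apply: cvg_norm; apply: cvgB; last exact: cvg_cst.
  by rewrite (cvg_shiftS x).
rewrite distrC; apply: (closed_cvg (fun r : R => r <= M * s k)) h.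
  exact: closed_le.
near=> n; apply: distance_le_sqrt_gap; near: n; exact: nbhs_infty_ge.
Unshelve. all: by end_near. Qed.

Let eta k := Num.sqrt (2 / c) * Num.sqrt (lam k)
  + M * Num.sqrt (2 * mu * a ^+ 2)^-1 * lam k.

(** The remaining path is the step t_(k+1) plus a tail O(s_(k+1)); since
    delta_(k+1) = O(lam_k^2 t_k^2), they are O(sqrt lam_k t_k) and O(lam_k t_k). *)
Lemma next_distance_le_step k : `|x k.+1 - z| <= eta k * t k.
Proof.
have h1 : b * lam k.+1 * t k.+1 ^+ 2 <= delta k.+1.
  by apply: (le_trans (sufficient_decrease _)); rewrite lerBlDr lerDl.
have h2 := gap_le_step k.
have m0 : 0 < 2 * mu * a ^+ 2 by rewrite !mulr_gt0// exprn_gt0.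
have hs : s k.+1 <= Num.sqrt (2 * mu * a ^+ 2)^-1 * (lam k * t k).
  apply: le_sqrt_mul; rewrite ?sqrtr_ge0 ?invr_ge0 ?(ltW m0) ?mulr_ge0 ?(ltW (lam0 k))//.
  by rewrite sqr_sqrtr// ler_pdivlMl// exprMn.
have ht : t k.+1 <= Num.sqrt (2 / c) * (Num.sqrt (lam k) * t k).
  apply: le_sqrt_mul; rewrite ?divr_ge0 ?(ltW c0) ?mulr_ge0 ?sqrtr_ge0//.
  rewrite exprMn sqr_sqrtr; last exact: ltW.
  rewrite mulrAC ler_pdivlMr//.
  have h3 : lam k ^+ 2 * t k ^+ 2 <= lam k * (2 * lam k.+1) * t k ^+ 2.
    by rewrite ler_wpM2r ?sqr_ge0// expr2 ler_wpM2l// ltW.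
  have h4 := ler_wpM2l (ltW m0) h1.
  rewrite -(ler_pM2l (lam0 k.+1)) /c; lra.
have h3 := distance_limit_le k.+1.
have h4 : M * s k.+1 <= M * (Num.sqrt (2 * mu * a ^+ 2)^-1 * (lam k * t k)).
  by rewrite ler_wpM2l// M_ge0.
have := ler_distD (x k.+2) (x k.+1) z; rewrite (distrC (x k.+1) (x k.+2)) /eta; lra.
Qed.

(** A step controls the distance to the limit as soon as lam is bounded; the proof
    that lam -> 0 rests on this comparison. *)
Lemma distance_le_step : exists2 K, 0 <= K & forall k, `|x k - z| <= K * t k.
Proof.
pose E := Num.sqrt (2 / c) * Num.sqrt Lmax
  + M * Num.sqrt (2 * mu * a ^+ 2)^-1 * Lmax.
exists (1 + E).
  apply: addr_ge0 => //; apply: addr_ge0; first by rewrite mulr_ge0 ?sqrtr_ge0.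
  exact: mulr_ge0 (mulr_ge0 M_ge0 (sqrtr_ge0 _)) (ltW Lmax0).
move=> k; have := next_distance_le_step k.
have : eta k * t k <= E * t k.
  rewrite ler_wpM2r// lerD// ler_wpM2l ?sqrtr_ge0//.
    exact: ler_wsqrtr.
  exact: mulr_ge0 M_ge0 (sqrtr_ge0 _).
have := ler_distD (x k.+1) (x k) z; rewrite (distrC (x k) (x k.+1)); lra.
Qed.

Hypothesis lam_cvg0 : lam @ \oo --> (0 : R).

Let sqrt_lam_cvg0 : (fun k => Num.sqrt (lam k)) @ \oo --> (0 : R).
Proof.
by rewrite -[X in _ --> X]sqrtr0; exact: (continuous_cvg _ (@sqrt_continuous _ _)).
Qed.

Lemma distance_superlinear : superlinear (fun k => `|x k - z|).
Proof.
have eta0 : eta @ \oo --> (0 : R).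
  rewrite -[X in _ --> X]addr0; apply: cvgD.
    by rewrite -[X in _ --> X](mulr0 (Num.sqrt (2 / c))); exact: cvgMr.
  rewrite -[X in _ --> X](mulr0 (M * Num.sqrt (2 * mu * a ^+ 2)^-1)).
  exact: cvgMr.
exists (fun k => 2 * eta k).
  rewrite -[X in _ --> X](mulr0 2); exact: cvgMr.
have : \forall k \near \oo, eta k < 2^-1 by apply: cvgr_lt eta0 _ _; rewrite invr_gt0.
apply: filterS => k hk; have h := next_distance_le_step k.
have e0 : 0 <= eta k.
  apply: addr_ge0; first by rewrite mulr_ge0 ?sqrtr_ge0.
  exact: mulr_ge0 (mulr_ge0 M_ge0 (sqrtr_ge0 _)) (ltW (lam0 k)).
have h1 : t k <= `|x k - z| + `|x k.+1 - z|.
  by have := ler_distD z (x k.+1) (x k); rewrite (distrC z); lra.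
have := ler_wpM2l e0 h1; have := normr_ge0 (x k.+1 - z).
nra.
Qed.

Lemma gap_superlinear : superlinear delta.
Proof.
exists (fun k => c^-1 * lam k).
  by rewrite -[X in _ --> X](mulr0 c^-1); exact: cvgMr.
by near=> k; rewrite -mulrA ler_pdivlMl// gap_contraction.
Unshelve. all: by end_near. Qed.

(** The step is eliminated through b lam_k t_k^2 <= delta_k <= g_k^2 / (2 mu), which
    loses a factor 1 / sqrt lam_k against the gain lam_k. *)
Lemma gradient_superlinear : superlinear g.
Proof.
exists (fun k => Num.sqrt (c^-1 * lam k)).
  rewrite -[X in _ --> X]sqrtr0; apply: (continuous_cvg _ (@sqrt_continuous _ _)).
  by rewrite -[X in _ --> X](mulr0 c^-1); exact: cvgMr.
near=> k; apply: le_sqrt_mul => //; first by rewrite mulr_ge0 ?invr_ge0 ?ltW.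
rewrite -mulrA ler_pdivlMl//.
have h : (a * g k.+1) ^+ 2 <= (lam k * t k) ^+ 2.
  by rewrite ler_sqr ?nnegrE ?mulr_ge0// ?ltW.
have h1 : b * lam k * t k ^+ 2 <= delta k.
  by apply: (le_trans (sufficient_decrease _)); rewrite lerBlDr lerDl.
have h2 : lam k * (2 * mu * (b * lam k * t k ^+ 2)) <= lam k * g k ^+ 2.
  rewrite ler_wpM2l//; first exact: ltW.
  apply: le_trans (gradient_dominated k).
  by rewrite ler_wpM2l// mulr_ge0// ltW.
have mb : 0 <= 2 * mu * b by rewrite !mulr_ge0// ltW.
have := ler_wpM2l mb h; rewrite !exprMn /c; lra.
Unshelve. all: by end_near. Qed.

End Rate.

(** * The iterates of the algorithm *)

(** The dichotomy followed by lam: halved, or eventually below any given bound. *)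
Lemma cvg0_of_halving (R : realType) (u : nat -> R) : (forall k, 0 <= u k) ->
  (forall e, 0 < e -> \forall k \near \oo, u k.+1 <= Num.max (u k / 2) e) ->
  u @ \oo --> (0 : R).
Proof.
move=> u0 h; apply/cvgrPdist_le => e e0.
have [N _ hN] := h e e0.
have claim i : u (i + N)%N <= Num.max (u N / 2 ^+ i) e.
  elim: i => [|i IH]; first by rewrite expr0 divr1 le_max lexx.
  have := hN (i + N)%N (leq_addl _ _); rewrite -addSn => /le_trans; apply.
  have h2 : Num.max (u N / 2 ^+ i) e / 2 <= Num.max (u N / 2 ^+ i.+1) e.
    rewrite le_max maxEle; case: ifP => _.
      by apply/orP; right; lra.
    by rewrite exprSr invfM mulrA lexx.
  rewrite ge_max [X in _ && X]le_max lexx orbT andbT (le_trans _ h2)//.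
  by rewrite ler_pM2r.
have g0 : (u N / 2 ^+ i) @[i --> \oo] --> (0 : R).
  rewrite -[X in _ --> X](mulr0 (u N)); apply: cvgMr.
  under eq_fun do rewrite -exprVn.
  by apply: cvg_expr; rewrite ger0_norm ?invr_ge0// invf_lt1// ltr1n.
have hg : \forall i \near \oo, u N / 2 ^+ i <= e by exact: cvgr_le g0 _ _.
have [N' _ hN'] := hg.
exists (N' + N)%N => // k /= kN; rewrite sub0r normrN ger0_norm//.
have kE : k = ((k - N) + N)%N by rewrite subnK// (leq_trans (leq_addl _ _) kN).
rewrite kE (le_trans (claim _))// ge_max lexx andbT.
by apply: hN'; rewrite /= leq_subRL ?(leq_trans (leq_addl _ _) kN)// addnC.
Qed.

(** The punctured limit becomes an estimate on a full neighbourhood, since both sides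
    vanish at z. *)
Lemma semismooth_residual (R : realType) (H : completeNormedModType R)
    (f : H -> R^o) (B : H -> H -> H -> R^o) (z : H) (e : R) :
  (forall y, sym_bounded_op (B y)) -> semismooth f B z -> 0 < e ->
  \forall y \near z,
    dual_norm (fder f y - fder f z - B y (y - z)) <= e * `|y - z|.
Proof.
move=> hB ss e0.
have : \forall h \near (0 : H)^',
    dual_norm (fder f (z + h) - fder f z - B (z + h) h) / `|h| < e.
  exact: cvgr_lt ss _ _.
rewrite near_withinE => /nbhs_ballP[d /= d0 hd].
apply/nbhs_ballP; exists d => // y; rewrite -ball_normE/= distrC => yd.
have [->|yz] := eqVneq y z.
  rewrite !subrr normr0 mulr0 sub0r dual_normN.
  apply: dual_norm_le => v _; rewrite (sbo_sym (hB z)) in_dual0 ?normr0//.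
  exact: sbo_dual.
have n0 : 0 < `|y - z| by rewrite normr_gt0 subr_eq0.
have := hd (y - z); rewrite -ball_normE/= sub0r normrN => /(_ yd).
rewrite subr_eq0 => /(_ yz).
rewrite (_ : z + (y - z) = y) ?ltr_pdivrMr//; last by rewrite addrC subrK.
exact: ltW.
Qed.

Section Leap.
Context {R : realType} {H : completeNormedModType R} (ip : {dot H for idfun}).
Variables (f : H -> R^o) (psi : H -> \bar R) (B : H -> H -> H -> R^o).
Variables (Fstar L mu m alpha beta : R) (x : nat -> H) (dF : nat -> H -> R^o).
Variables (Lam lam : nat -> R) (j : nat -> nat) (xp : nat -> R -> H).
Local Notation F := (objective f psi).
Local Notation xplus := (fun k => xp k (lam k / 2)).
Local Notation res := (newton_residual f B).
Hypothesis hip : hilbert ip.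
Hypothesis df : forall z, differentiable f z.
Hypotheses (pp : proper psi) (cp : convex_on setT psi).
Hypothesis lp : lower_semicontinuous psi.
Hypothesis hFstar : Fstar%:E = ereal_inf (range F).
Hypothesis hB : forall z, sym_bounded_op (B z).
Hypothesis L0 : 0 <= L.
Hypothesis hres : forall z y, dual_norm (res z y) <= L * `|z - y|.
Hypothesis hsub : subproblem_assumption ip f psi B L.
Hypothesis mu0 : 0 < mu.
Hypothesis hPL : forall z, domain F z ->
  (F z - Fstar%:E
     <= (1 / (2 * mu))%:E * dist0 (obj_subdiff f psi z) ^+ 2)%E.
Hypothesis hleap : leap_ssn ip f psi B m alpha beta x dF Lam lam j xp.

Let delta k := fine (F (x k) - Fstar%:E)%E.
Local Notation t k := `|x k.+1 - x k|.

Lemma leap_Lam_gt0 k : 0 < Lam k.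
Proof.
elim: k => [|k IH]; first exact: leap_Lam0 hleap.
by rewrite (leap_Lam hleap) (leap_lam hleap) divr_gt0// mulr_gt0// exprn_gt0.
Qed.

Lemma leap_lam_gt0 k : 0 < lam k.
Proof. by rewrite (leap_lam hleap) mulr_gt0 ?leap_Lam_gt0// exprn_gt0. Qed.

Lemma leap_lam_halving k : lam k <= 2 * lam k.+1.
Proof.
rewrite [lam k.+1](leap_lam hleap) (leap_Lam hleap).
have -> : 2 * (2 ^+ j k.+1 * (lam k / 2)) = 2 ^+ j k.+1 * lam k :> R by field.
by rewrite ler_peMl ?(ltW (leap_lam_gt0 k))// exprn_ege1// ler1n.
Qed.

Lemma leap_subgradient k :
  exists2 p, subdiff psi (x k) p & dF k = fder f (x k) + p.
Proof.
case: k => [|k]; first by have [p] := leap_dF0 hleap; exists p.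
exists (psi_der ip f B (x k) (lam k) (x k.+1)); last exact: leap_dF hleap _.
by have [] := leap_admissible hleap k; rewrite -(leap_next hleap).
Qed.

Lemma leap_psi_finite k : psi (x k) \is a fin_num.
Proof. by have [p hp _] := leap_subgradient k; exact: subdiff_finite hp. Qed.

Lemma leap_objE k : F (x k) = (f (x k) + fine (psi (x k)))%:E.
Proof. by rewrite EFinD fineK// leap_psi_finite. Qed.

Lemma leap_deltaE k : delta k = f (x k) + fine (psi (x k)) - Fstar.
Proof. by rewrite /delta leap_objE. Qed.

Lemma Fstar_le z : (Fstar%:E <= F z)%E.
Proof. by rewrite hFstar; apply: ereal_inf_lbound; exists z. Qed.

Lemma leap_delta_ge0 k : 0 <= delta k.
Proof.
by rewrite leap_deltaE subr_ge0 -lee_fin -leap_objE Fstar_le.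
Qed.

Lemma in_dual_leap_dF k : in_dual (dF k).
Proof.
have [p hp ->] := leap_subgradient k.
by apply: in_dual_add; [exact: in_dual_fder|exact: subdiff_in_dual hp].
Qed.

Lemma leap_gradient_dominated k : 2 * mu * delta k <= dual_norm (dF k) ^+ 2.
Proof.
have [p hp hdF] := leap_subgradient k.
have gn := dual_norm_ge0 (in_dual_leap_dF k).
have dx : domain F (x k) by rewrite /domain/= leap_objE ltry.
have := hPL dx; rewrite leap_objE -EFinB -leap_deltaE => h.
have d0 : (0 <= dist0 (obj_subdiff f psi (x k)))%E.
  apply: le_ereal_inf_tmp => _ [_ [q hq <-] <-]; rewrite lee_fin.
  apply: dual_norm_ge0; apply: in_dual_add; first exact: in_dual_fder.
  exact: subdiff_in_dual hq.
have d1 : (dist0 (obj_subdiff f psi (x k)) <= (dual_norm (dF k))%:E)%E.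
  by apply: ereal_inf_lbound; exists (dF k) => //; exists p.
have d2 : (dist0 (obj_subdiff f psi (x k)) ^+ 2 <= (dual_norm (dF k) ^+ 2)%:E)%E.
  by rewrite EFin_expe !expe2 lee_pmul.
have c0 : (0 <= (1 / (2 * mu))%:E)%E.
  by rewrite lee_fin divr_ge0// mulr_ge0// ltW.
have := le_trans h (lee_wpmul2l c0 d2); rewrite -EFinM lee_fin mul1r.
by rewrite ler_pdivlMl// mulr_gt0.
Qed.

Lemma leap_sufficient_decrease k :
  beta * lam k * t k ^+ 2 <= delta k - delta k.+1.
Proof.
have [_] := leap_accept hleap k; rewrite -(leap_next hleap) !leap_objE.
by rewrite -EFinB lee_fin !leap_deltaE => h; rewrite opprB addrA subrK.
Qed.

Lemma leap_gradient_bound k : alpha * dual_norm (dF k.+1) <= lam k * t k.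
Proof.
have [h _] := leap_accept hleap k; move: h.
rewrite -(leap_next hleap) -(leap_dF hleap) => h.
have hd := in_dual_leap_dF k.+1; have l0 := leap_lam_gt0 k.
have := le_trans h (dual_le _ hd); rewrite distrC.
have := dual_norm_ge0 hd; set g := dual_norm _; rewrite le_eqVlt.
move=> /predU1P[<-|g0]; first by rewrite mulr0 mulr_ge0// ltW.
rewrite mulrAC ler_pdivrMr// => h2; rewrite -(ler_pM2r g0); lra.
Qed.

(** When some trial was rejected, the last rejected parameter is lam_k / 2; it is the
    only rejection that matters. *)
Lemma leap_reject_half k : (0 < j k)%N ->
  ~ (admissible ip f psi B (x k) (lam k / 2) (xplus k) /\
     accept ip f psi B alpha beta (x k) (lam k / 2) (xplus k)).
Proof.
move=> jk; have jk1 : ((j k).-1 < j k)%N by rewrite prednK.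
have := leap_reject hleap jk1.
suff -> : 2 ^+ (j k).-1 * Lam k = lam k / 2 by [].
by rewrite (leap_lam hleap) -[in RHS](prednK jk) exprS; field.
Qed.

Lemma leap_no_reject k : j k.+1 = 0%N -> lam k.+1 = lam k / 2.
Proof. by move=> j0; rewrite (leap_lam hleap) j0 expr0 mul1r (leap_Lam hleap). Qed.

Let m1 : 1 <= m := leap_m hleap.
Let alpha2 : alpha <= 2^-1. Proof. by have /andP[] := leap_alpha hleap. Qed.
Let alpha0 : 0 < alpha. Proof. by have /andP[] := leap_alpha hleap. Qed.
Let beta0 : 0 < beta. Proof. by have /andP[] := leap_beta hleap. Qed.
Let beta_m : beta <= (m - 1) / (2 * m). Proof. by have /andP[] := leap_beta hleap. Qed.
Let beta2 : beta <= 2^-1.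
Proof.
apply: le_trans beta_m _.
by have m1' := m1; rewrite ler_pdivrMr; lra.
Qed.

(** A parameter of at least m L passes both tests, so a rejected lam_k / 2 is below
    it. *)
Lemma leap_lam_lt_of_reject k : (0 < j k)%N -> lam k < 2 * m * L.
Proof.
move=> jk; rewrite ltNge; apply/negP => hl.
have mL : L <= m * L by rewrite ler_peMl.
have l2 : 0 < lam k / 2 by rewrite divr_gt0 ?leap_lam_gt0.
have hL : m * L <= lam k / 2 by lra.
have dx : domain F (x k) by rewrite /domain/= leap_objE ltry.
have hadm : admissible ip f psi B (x k) (lam k / 2) (xplus k).
  by apply: (leap_sel hleap); [exact: ltW|exact: hsub (le_trans mL hL) dx].
apply: (leap_reject_half jk); split => //.
have fy := subdiff_finite pp hadm.1.
split.
  apply: (gradient_test_of_small_residual hip df hB) => //.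
  apply: (le_trans (hres _ _)); rewrite distrC ler_wpM2r//; lra.
exact: (decrease_test_of_large_parameter df hB m1 beta_m hL l2
  (hres _) (esym (fineK (leap_psi_finite k))) (esym (fineK fy)) hadm).
Qed.

Lemma leap_lam_bounded k : lam k <= Num.max (lam 0%N) (2 * m * L).
Proof.
elim: k => [|k IH]; first by rewrite le_max lexx.
have [jk|jk] := posnP (j k.+1).
  apply: le_trans IH; rewrite (leap_no_reject jk); have := leap_lam_gt0 k; lra.
by rewrite le_max (ltW (leap_lam_lt_of_reject jk)) orbT.
Qed.

Lemma leap_gap_cvg0 : delta @ \oo --> (0 : R).
Proof.
exact: (gap_cvg0 alpha0 beta0 mu0 leap_lam_gt0 leap_delta_ge0
  (fun k => dual_norm_ge0 (in_dual_leap_dF k)) leap_sufficient_decrease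
  leap_gradient_bound leap_gradient_dominated leap_lam_bounded).
Qed.

Variable xstar : H.
Hypothesis hcluster : cluster (x @ \oo) xstar.

Lemma leap_cvg : x @ \oo --> xstar.
Proof.
have /cvg_ex[z xz] := iterates_cvg alpha0 beta0 mu0 leap_lam_gt0 leap_delta_ge0
  (fun k => dual_norm_ge0 (in_dual_leap_dF k)) leap_sufficient_decrease
  leap_gradient_bound leap_gradient_dominated leap_lam_halving leap_lam_bounded.
suff -> : xstar = z by [].
by apply/esym/norm_hausdorff; exact: cvg_cluster xz _ hcluster.
Qed.

Lemma leap_limit_minimizes : F xstar = Fstar%:E.
Proof.
apply/eqP; rewrite eq_le Fstar_le andbT.
apply: (@lsc_sum_cvg_le _ _ psi x xstar (f \o x) (fun k => delta k + Fstar)) => //.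
- exact: leap_cvg.
- by apply: continuous_cvg leap_cvg; exact: differentiable_continuous.
- by rewrite -[X in _ --> X]add0r; apply: cvgD; [exact: leap_gap_cvg0|exact: cvg_cst].
- by move=> k; rewrite leap_deltaE subrK -leap_objE.
Qed.

Hypothesis hpsd : \forall k \near \oo, psd (B (x k)).

Lemma leap_half_admissible k : psd (B (x k)) ->
  admissible ip f psi B (x k) (lam k / 2) (xplus k).
Proof.
move=> pk; have l2 : 0 < lam k / 2 by rewrite divr_gt0 ?leap_lam_gt0.
apply: (leap_sel hleap); first exact: ltW.
have [p hp _] := leap_subgradient k.
exact: (psd_admissible_exists hip (in_dual_fder (df _)) pp cp lp hp).
Qed.

(** The trial point for lam_k / 2 is not an iterate, yet its step is comparable with
    the accepted one, so every estimate by t_k transfers to it. *)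
Lemma leap_half_step k : psd (B (x k)) ->
  t k <= `|xplus k - x k| /\ `|xplus k - x k| <= 2 * t k.
Proof.
move=> pk; have l0 := leap_lam_gt0 k.
have [h _] := leap_half_admissible pk.
have [h1 _] := leap_admissible hleap k.
have l2 : 0 < lam k / 2 by rewrite divr_gt0.
have l21 : lam k / 2 < lam k by lra.
have [] := prox_step_antimonotone hip df hB pp pk l2 l21 h1 h.
rewrite -(leap_next hleap) => h2 h3; split => //.
by move: h3; rewrite -mulrA ler_pM2l//; lra.
Qed.

Lemma leap_step_cvg0 : t k @[k --> \oo] --> (0 : R).
Proof.
rewrite -(normr0 H) -(subrr xstar); apply: cvg_norm; apply: cvgB => //.
  by rewrite (cvg_shiftS x); exact: leap_cvg.
exact: leap_cvg.
Qed.

Lemma leap_half_cvg : xplus @ \oo --> xstar.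
Proof.
have h : (fun k => xplus k - x k) @ \oo --> (0 : H).
  apply: norm_cvg0.
  apply: (@squeeze_cvgr _ _ _ _ (cst 0) (fun k => 2 * t k)).
  - near=> k; rewrite /cst normr_ge0/=.
    have pk : psd (B (x k)) by near: k; exact: hpsd.
    by have [] := leap_half_step pk.
  - exact: cvg_cst.
  - by rewrite -[X in _ --> X](mulr0 2); apply: cvgMr; exact: leap_step_cvg0.
have -> : xplus = (fun k => (xplus k - x k) + x k).
  by apply/funext => k; rewrite subrK.
by rewrite -[X in _ --> X]add0r; apply: cvgD => //; exact: leap_cvg.
Unshelve. all: by end_near. Qed.

(** The residual between x_k and x_(k,+) is the difference of the semismoothness
    errors at the two points plus the change of B applied to x_(k,+) - xstar. The
    errors are small relative to the distances to xstar, and these are bounded by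
    the trial step through [distance_le_step] and [leap_half_step]. *)
Lemma leap_residual_of_jacobian_consistency :
  semismooth f B xstar ->
  ((fun k => dual_norm (B (xplus k) (xplus k - xstar)
                        - B (x k) (xplus k - xstar)) : R^o)
     =o_\oo (fun k => `|xplus k - x k| : R^o)) ->
  forall e, 0 < e -> \forall k \near \oo,
    dual_norm (res (x k) (xplus k)) <= e * `|xplus k - x k|.
Proof.
move=> ss /eqoP ho e e0.
have [K K0 hK] := distance_le_step alpha0 beta0 mu0 leap_lam_gt0 leap_delta_ge0
  (fun k => dual_norm_ge0 (in_dual_leap_dF k)) leap_sufficient_decrease
  leap_gradient_bound leap_gradient_dominated leap_lam_halving leap_lam_bounded
  leap_cvg.
(* x_k and x_(k,+) are within K and K + 1 trial steps of xstar: half of e pays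
   for the two semismoothness errors, half for the change of B. *)
pose e2 := e / (2 * (2 * K + 1)).
have K1 : 0 < 2 * K + 1 by lra.
have e20 : 0 < e2 by rewrite divr_gt0// mulr_gt0.
have ss2 := semismooth_residual hB ss e20.
have e3 : 0 < e / 2 by rewrite divr_gt0.
have hx : \forall k \near \oo,
    dual_norm (fder f (x k) - fder f xstar - B (x k) (x k - xstar))
   <= e2 * `|x k - xstar| by exact: leap_cvg ss2.
have hxp : \forall k \near \oo,
    dual_norm (fder f (xplus k) - fder f xstar - B (xplus k) (xplus k - xstar))
   <= e2 * `|xplus k - xstar| by exact: leap_half_cvg ss2.
near=> k.
have pk : psd (B (x k)) by near: k; exact: hpsd.
have h1 : dual_norm (fder f (x k) - fder f xstar - B (x k) (x k - xstar))
   <= e2 * `|x k - xstar| by near: k.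
have h2 :
    dual_norm (fder f (xplus k) - fder f xstar - B (xplus k) (xplus k - xstar))
   <= e2 * `|xplus k - xstar| by near: k.
have h3 : dual_norm (B (xplus k) (xplus k - xstar) - B (x k) (xplus k - xstar))
    <= e / 2 * `|xplus k - x k|.
  apply: le_trans (ler_norm _) _.
  rewrite -[X in _ <= _ * X]normr_id; near: k; exact: (ho _ e3).
have [s1 s2] := leap_half_step pk.
have k1 := hK k.
have rE : res (x k) (xplus k) =
    (B (xplus k) (xplus k - xstar) - B (x k) (xplus k - xstar))
    + ((fder f (xplus k) - fder f xstar - B (xplus k) (xplus k - xstar))
       - (fder f (x k) - fder f xstar - B (x k) (x k - xstar))).
  apply/funext => v; rewrite /newton_residual !fctE.
  have -> : xplus k - x k = (xplus k - xstar) - (x k - xstar).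
    by rewrite opprB addrA subrK.
  rewrite (sboBl (hB _)).
  ring.
have i1 : in_dual (B (xplus k) (xplus k - xstar) - B (x k) (xplus k - xstar)).
  by apply: in_dual_sub; exact: sbo_dual.
have i2 y : in_dual (fder f y - fder f xstar - B y (y - xstar)).
  by apply: in_dual_sub; [apply: in_dual_sub; exact: in_dual_fder|exact: sbo_dual].
rewrite rE; apply: le_trans (dual_norm_triangle i1 (in_dual_sub (i2 _) (i2 _))) _.
have := dual_norm_triangle (i2 (xplus k)) (in_dual_opp (i2 (x k))).
rewrite dual_normN => h4.
have h5 := ler_distD (x k) (xplus k) xstar.
have h6 : K * t k <= K * `|xplus k - x k| by rewrite ler_wpM2l.
have h7 : e2 * (`|xplus k - xstar| + `|x k - xstar|)
    <= e2 * ((2 * K + 1) * `|xplus k - x k|).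
  by rewrite ler_wpM2l ?(ltW e20)//; lra.
have e2E : e2 * (2 * K + 1) = e / 2 by rewrite /e2; field; rewrite gt_eqF.
rewrite mulrA e2E in h7; lra.
Unshelve. all: by end_near. Qed.

Lemma leap_residual_of_quotient :
  (dual_norm (res (x k) (xplus k)) / `|xplus k - x k|) @[k --> \oo] --> (0 : R) ->
  forall e, 0 < e -> \forall k \near \oo,
    dual_norm (res (x k) (xplus k)) <= e * `|xplus k - x k|.
Proof.
move=> hq e e0; have : \forall k \near \oo,
    dual_norm (res (x k) (xplus k)) / `|xplus k - x k| < e by exact: cvgr_lt hq _ _.
apply: filterS => k.
have [h _|n0] := eqVneq (`|xplus k - x k|) 0.
  by apply: (le_trans (hres _ _)); rewrite distrC h !mulr0.
have n1 : 0 < `|xplus k - x k| by rewrite lt_def n0 normr_ge0.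
by rewrite ltr_pdivrMr//; exact: ltW.
Qed.

Hypothesis hconv : exists2 r : R, 0 < r & convex_on (ball xstar r) F.
Hypothesis hsmall : forall e, 0 < e -> \forall k \near \oo,
    dual_norm (res (x k) (xplus k)) <= e * `|xplus k - x k|.

(** If lam_k stayed above e after a rejection, the trial point for lam_k / 2 would
    have passed both tests, its residual being at most lam_k / 4 times its step. *)
Lemma leap_lam_cvg0 : lam @ \oo --> (0 : R).
Proof.
apply: cvg0_of_halving => [k|e e0]; first exact: ltW (leap_lam_gt0 k).
have [r r0 cF] := hconv.
suff hnr : \forall k \near \oo, (0 < j k)%N -> lam k <= e.
  have [N _ hN] := hnr; exists N => // k kN; rewrite le_max.
  have [jk|jk] := posnP (j k.+1); first by rewrite (leap_no_reject jk) lexx.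
  by rewrite (hN k.+1 _ jk) ?orbT//=; exact: leqW.
have e4 : 0 < e / 4 by rewrite divr_gt0.
have bx : \forall k \near \oo, ball xstar r (x k).
  by apply: leap_cvg; exact: nbhsx_ballx.
have bxp : \forall k \near \oo, ball xstar r (xplus k).
  by apply: leap_half_cvg; exact: nbhsx_ballx.
near=> k => jk; rewrite leNgt; apply/negP => le.
have pk : psd (B (x k)) by near: k; exact: hpsd.
have hadm := leap_half_admissible pk.
have fy := subdiff_finite pp hadm.1.
have l2 : 0 < lam k / 2 by rewrite divr_gt0 ?leap_lam_gt0.
have hr : dual_norm (res (x k) (xplus k)) <= lam k / 2 / 2 * `|xplus k - x k|.
  have h : dual_norm (res (x k) (xplus k)) <= e / 4 * `|xplus k - x k|.
    by near: k; exact: hsmall.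
  by apply: (le_trans h); rewrite ler_wpM2r//; lra.
apply: (leap_reject_half jk); split => //; split.
  apply: (gradient_test_of_small_residual hip df hB) => //.
  by apply: (le_trans hr); rewrite ler_wpM2r//; lra.
have bxk : ball xstar r (x k) by near: k.
have bxpk : ball xstar r (xplus k) by near: k.
exact: (decrease_test_of_local_convexity hip df hB cF bxk bxpk beta2 l2 hr
  (esym (fineK (leap_psi_finite k))) (esym (fineK fy)) hadm.1).
Unshelve. all: by end_near. Qed.

Lemma leap_superlinear :
  [/\ F xstar = Fstar%:E, superlinear (fun k => `|x k - xstar|),
      superlinear delta & superlinear (fun k => dual_norm (dF k))].
Proof.
have gn k := dual_norm_ge0 (in_dual_leap_dF k).
split; first exact: leap_limit_minimizes.
- exact: (distance_superlinear alpha0 beta0 mu0 leap_lam_gt0 leap_delta_ge0 gn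
    leap_sufficient_decrease leap_gradient_bound leap_gradient_dominated
    leap_lam_halving leap_lam_bounded leap_cvg leap_lam_cvg0).
- exact: (gap_superlinear alpha0 beta0 mu0 leap_lam_gt0 leap_delta_ge0 gn
    leap_sufficient_decrease leap_gradient_bound leap_gradient_dominated
    leap_lam_cvg0).
- exact: (gradient_superlinear alpha0 beta0 mu0 leap_lam_gt0 leap_delta_ge0 gn
    leap_sufficient_decrease leap_gradient_bound leap_gradient_dominated
    leap_lam_cvg0).
Qed.

End Leap.

Theorem theorem6p7 (R : realType) (H : completeNormedModType R)
  (ip : {dot H for idfun}) (f : H -> R^o) (psi : H -> \bar R)
  (B : H -> H -> H -> R^o) (Fstar L mu : R)
  (m alpha beta : R) (x : nat -> H) (dF : nat -> H -> R^o)
  (Lam lam : nat -> R) (j : nat -> nat) (xp : nat -> R -> H) (xstar : H)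
  (F := objective f psi) (xplus := fun k => xp k (lam k / 2)) :
  hilbert ip ->
  C11 f ->
  proper psi -> convex_on setT psi -> lower_semicontinuous psi ->
  Fstar%:E = ereal_inf (range F) ->
  [set z | F z = Fstar%:E] !=set0 ->
  (forall z, sym_bounded_op (B z)) ->
  0 <= L ->
  (forall z y,
     dual_norm (fder f y - fder f z - B z (y - z)) <= L * `|z - y|) ->
  subproblem_assumption ip f psi B L ->
  0 < mu ->
  (forall z, domain F z ->
     (F z - Fstar%:E
        <= (1 / (2 * mu))%:E * dist0 (obj_subdiff f psi z) ^+ 2)%E) ->
  leap_ssn ip f psi B m alpha beta x dF Lam lam j xp ->
  cluster (x @ \oo) xstar ->
  (exists2 r : R, 0 < r & convex_on (ball xstar r) F) ->
  semismooth f B xstar ->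
  (\forall k \near \oo, psd (B (x k))) ->
  ((fun k => dual_norm (B (xplus k) (xplus k - xstar)
                        - B (x k) (xplus k - xstar)) : R^o)
     =o_\oo (fun k => `|xplus k - x k| : R^o)) \/
  (dual_norm (fder f (xplus k) - fder f (x k) - B (x k) (xplus k - x k))
     / `|xplus k - x k|) @[k --> \oo] --> (0 : R) ->
  [/\ F xstar = Fstar%:E,
      superlinear (fun k => `|x k - xstar|),
      superlinear (fun k => fine (F (x k) - Fstar%:E)%E) &
      superlinear (fun k => dual_norm (dF k))].
Proof.
move=> hip [df _] pp cp lp hF _ hB L0 hres hsub mu0 hPL hleap hc hconv ss hpsd hcase.
apply: leap_superlinear; try eassumption.
by case: hcase => [ho|hq];
  [apply: leap_residual_of_jacobian_consistency|apply: leap_residual_of_quotient];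
  eassumption.
Qed.
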